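(* Let $\ell$ be the quantum characteristic of $(K,q)$. Suppose that $\ell>0$ and that the order of $q$ is odd if $q\neq\pm1$. Then there exists a functor $\operatorname{Frob}^{\ast}\colon\mathcal X_{(K,1)}\to\mathcal X_{(K,q)}$ with the property that, for all $\lambda\in X$, $$\operatorname{Frob}^{\ast}(S_{(K,1)}(\lambda))\cong S_{(K,q)}(\ell\lambda).$$
   Context: $R$ is a simply laced root system (i.e. $\langle\alpha,\beta^\vee\rangle\in\{0,-1\}$ for $\alpha\ne\beta$ in the basis) with basis $\Pi$ and weight lattice $X$; $\alpha^\vee$ is the coroot of $\alpha$. Partial order on $X$: $\mu\le\lambda$ iff $\lambda-\mu$ is a (possibly empty) sum of elements of $\Pi$. A subset $T\subset X$ is quasi-bounded (from above) if for all $\mu\in X$ the set $\{\lambda\in T\mid\mu\le\lambda\}$ is finite. $K$ is a field and $q\in K^\times$. Quantum numbers: in $\mathbb Z[v,v^{-1}]$ set $[n]=\frac{v^n-v^{-n}}{v-v^{-1}}$ for $n\in\mathbb Z$, and for $a,b\in\mathbb Z$ let ${a\brack b}=\frac{[a][a-1]\cdots[a-b+1]}{[1][2]\cdots[b]}\in\mathbb Z[v,v^{-1}]$ if $b>0$, ${a\brack 0}=1$, and ${a\brack b}=0$ if $b<0$. These are regarded as elements of $K$ via $v\mapsto q$. The quantum characteristic $\ell$ of $(K,q)$ is $0$ if $[n]\ne0$ in $K$ for all $n\neq0$, and otherwise the smallest positive integer $\ell$ with $[\ell]=0$ in $K$. The category $\mathcal X_{(K,q)}$: objects are $X$-graded $K$-vector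 spaces $M=\bigoplus_{\mu\in X}M_\mu$ with $K$-linear operators $E_{\alpha,n}=E_{\mu,\alpha,n}\colon M_\mu\to M_{\mu+n\alpha}$ and $F_{\alpha,n}=F_{\mu,\alpha,n}\colon M_{\mu+n\alpha}\to M_\mu$ for all $\mu\in X$, $\alpha\in\Pi$, $n>0$ (with $E_{\mu,\alpha,0}=F_{\mu,\alpha,0}=\operatorname{id}_{M_\mu}$ and $E_{\mu,\alpha,n}=F_{\mu,\alpha,n}=0$ for $n<0$), such that: (X1) The set of $\mu$ with $M_\mu\ne0$ is quasi-bounded from above and each $M_\mu$ is finite dimensional. (X2) For all $\mu\in X$, $\alpha,\beta\in\Pi$, $m,n>0$ and $v\in M_{\mu+n\beta}$: $E_{\alpha,m}F_{\beta,n}(v)=F_{\beta,n}E_{\alpha,m}(v)$ if $\alpha\ne\beta$, and $E_{\alpha,m}F_{\alpha,n}(v)=\sum_{r\in\mathbb Z}{\langle\mu,\alpha^\vee\rangle+m+n\brack r}F_{\alpha,n-r}E_{\alpha,m-r}(v)$ if $\alpha=\beta$. (X3) For all $\mu\in X$: $M_\mu=\ker E_\mu\oplus\operatorname{im}F_\mu$, where $M_{\delta\mu}:=\bigoplus_{\alpha\in\Pi,n>0}M_{\mu+n\alpha}$, $E_\mu\colon M_\mu\to M_{\delta\mu}$ has components $E_{\mu,\alpha,n}$, and $F_\mu\colon M_{\delta\mu}\to M_\mu$ is $(v_{\mu+n\alpha})\mapsto\sum_{\alpha,n}F_{\mu,\alpha,n}(v_{\mu+n\alpha})$. Morphisms are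 grading-preserving $K$-linear maps commuting with all $E$- and $F$-operators. $\mathcal X_{(K,1)}$ is the same category with $q$ replaced by $1$ (so the coefficients are ordinary binomial coefficients). For $\lambda\in X$, $S_{(K,q)}(\lambda)$ denotes the up to isomorphism unique object of $\mathcal X_{(K,q)}$ that is indecomposable, with $\dim_KS_{(K,q)}(\lambda)_\lambda=1$, and such that $S_{(K,q)}(\lambda)_\mu\neq0$ implies $\mu\le\lambda$. *)

(* Defs.v *)
From HB Require Import structures.
From mathcomp Require Import all_boot all_order all_algebra.
From mathcomp Require Import boolp classical_sets cardinality.

Set Implicit Arguments.
Unset Strict Implicit.
Unset Printing Implicit Defensive.

Import Order.TTheory GRing.Theory Num.Theory.
Local Open Scope ring_scope.

Record category := Category {
  ob :> Type;
  hom : ob -> ob -> Type;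
  idm : forall A, hom A A;
  comp : forall A B C, hom B C -> hom A B -> hom A C;
  comp_idl : forall A B (f : hom A B), comp (idm B) f = f;
  comp_idr : forall A B (f : hom A B), comp f (idm A) = f;
  compA : forall A B C D (f : hom C D) (g : hom B C) (h : hom A B),
    comp f (comp g h) = comp (comp f g) h }.

Record functor (C D : category) := Functor {
  fob :> C -> D;
  fhom : forall A B : C, hom A B -> hom (fob A) (fob B);
  fhom_id : forall A : C, fhom (idm A) = idm (fob A);
  fhom_comp : forall (A B E : C) (f : hom B E) (g : hom A B),
    fhom (comp f g) = comp (fhom f) (fhom g) }.

Definition isomorphic (C : category) (A B : C) : Prop :=
  exists (f : hom A B) (g : hom B A), comp g f = idm A /\ comp f g = idm B.

(* Over Q and R this is the usual notion of a (reduced) root system.  Only the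
   values of [coroot] at roots matter; there it is determined by [roots]. *)
Record rootSystem (F : archiRealFieldType) (V : vectType F) := RootSystem {
  roots : seq V;
  coroot : V -> {scalar V};
  roots_span : <<roots>>%VS = fullv;
  roots_neq0 : 0 \notin roots;
  coroot2 : forall a, a \in roots -> coroot a a = 2;
  roots_refl : forall a b, a \in roots -> b \in roots ->
    b - coroot a b *: a \in roots;
  roots_int : forall a b, a \in roots -> b \in roots ->
    coroot a b \is a Num.int;
  roots_reduced : forall (a : V) (c : F), a \in roots -> c *: a \in roots ->
    c = 1 \/ c = -1 }.

Record rootBasis (F : archiRealFieldType) (V : vectType F)
    (R : rootSystem V) := RootBasis {
  simple : seq V;
  simple_roots : {subset simple <= roots R};
  simple_free : free simple;
  simple_sum : forall b, b \in roots R -> exists c : V -> nat,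
    b = \sum_(a <- simple) a *+ c a \/ b = - \sum_(a <- simple) a *+ c a }.

Section Weights.
Variables (F : archiRealFieldType) (V : vectType F) (R : rootSystem V).

Definition is_weight : {pred V} :=
  [pred x | all (fun a => coroot R a x \is a Num.int) (roots R)].

Fact is_weight_zmod_closed : zmod_closed is_weight.
Proof.
split=> [|x y /allP xP /allP yP]; apply/allP => a aR.
  by rewrite linear0 rpred0.
by rewrite linearB rpredB ?xP ?yP.
Qed.

HB.instance Definition _ :=
  GRing.isZmodClosed.Build V is_weight is_weight_zmod_closed.

Record weight := Weight { wval :> V; wvalP : wval \in is_weight }.

HB.instance Definition _ := [isSub for wval].
HB.instance Definition _ := [Choice of weight by <:].
HB.instance Definition _ := [SubChoice_isSubZmodule of weight by <:].

Variable Pi : rootBasis R.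

Definition simpleRoot := seq_sub (simple Pi).
HB.instance Definition _ := Finite.on simpleRoot.

Fact sroot_subproof (a : simpleRoot) : ssval a \in is_weight.
Proof.
apply/allP => b bR; apply: (roots_int bR).
exact: (simple_roots (ssvalP a)).
Qed.

Definition sroot (a : simpleRoot) : weight := Weight (sroot_subproof a).

(* The floor of an integer of [F]: this is <mu, a^vee> as an element of Z. *)
Definition pairing (mu : weight) (a : simpleRoot) : int :=
  Num.floor (coroot R (ssval a) (wval mu) : F).

Fact pairingE (mu : weight) (a : simpleRoot) :
  (pairing mu a)%:~R = coroot R (ssval a) (wval mu) :> F.
Proof.
rewrite /pairing floorK //.
by move/allP: (wvalP mu); apply; exact: (simple_roots (ssvalP a)).
Qed.

Definition simply_laced : Prop :=
  forall a b : simpleRoot, a != b ->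
    pairing (sroot a) b = 0 \/ pairing (sroot a) b = -1.

Definition wle (mu la : weight) : Prop :=
  exists c : simpleRoot -> nat, la - mu = \sum_a sroot a *+ c a.

Definition quasi_bounded (T : set weight) : Prop :=
  forall mu, finite_set [set la | T la /\ wle mu la]%classic.

End Weights.

Definition qint (T : fieldType) (v : T) (n : int) : T :=
  (v ^ n - v ^ (- n)) / (v - v^-1).

Definition qbin (T : fieldType) (v : T) (a b : int) : T :=
  if b is Posz k then
    (\prod_(0 <= i < k) qint v (a - i%:Z)) / \prod_(1 <= i < k.+1) qint v i%:Z
  else 0.

(* Laurent polynomials are handled inside the fraction field of Z[v], so that
   [n] and the quantum binomials are [qint qv n] and [qbin qv a b]; they are
   specialized to K afterwards (the quotients make no sense in K itself). *)
Definition qv : {fraction {poly int}} := @FracField.tofrac {poly int} 'X.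

(* The image in K of the Laurent polynomial f under v |-> q: write
   f = p / v^k with p in Z[v] and return p(q) / q^k. *)
Definition specialize (K : fieldType) (q : K) (f : {fraction {poly int}}) : K :=
  let pk := xget (0, 0%N) [set pk : {poly int} * nat |
    f = @FracField.tofrac {poly int} pk.1 / qv ^+ pk.2]%classic in
  (map_poly intr pk.1).[q] / q ^+ pk.2.

Fact qv_neq0 : qv != 0.
Proof. by rewrite tofrac_eq0 polyX_eq0. Qed.

Fact specialize_frac (K : fieldType) (q : K) (p : {poly int}) (k : nat) :
  q != 0 ->
  specialize q (@FracField.tofrac {poly int} p / qv ^+ k) =
  (map_poly intr p).[q] / q ^+ k.
Proof.
move=> q0; rewrite /specialize.
case: xgetP => [[p' k'] _ /= |/(_ (p, k))/= /(_ erefl) []] E.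
have X0 n : qv ^+ n != 0 by rewrite expf_neq0 ?qv_neq0.
have : p * 'X^k' = p' * 'X^k.
  apply/eqP; rewrite -tofrac_eq !rmorphM !rmorphXn /= -/qv.
  by rewrite -eqr_div // E.
move/(congr1 (fun r => (map_poly (intr : int -> K) r).[q])).
rewrite !rmorphM /= !map_polyXn !hornerM !hornerXn => /eqP.
by rewrite -eqr_div ?expf_neq0 // => /eqP.
Qed.

Definition quantum_characteristic (K : fieldType) (q : K) (l : nat) : Prop :=
  (l = 0%N /\ forall n : int, n != 0 -> specialize q (qint qv n) != 0) \/
  [/\ (0 < l)%N, specialize q (qint qv l%:Z) = 0
    & forall k : nat, (0 < k < l)%N -> specialize q (qint qv k%:Z) != 0].

Section CategoryX.
Variables (F : archiRealFieldType) (V : vectType F) (R : rootSystem V).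
Variables (Pi : rootBasis R) (K : fieldType) (q : K).

Local Notation weight := (weight R).
Local Notation simpleRoot := (simpleRoot Pi).

(* [opE a n mu nu : M_mu -> M_nu] is the (mu, nu)-component of the operator
   E_(a,n), which is homogeneous of degree n a: the data are E_(mu,a,n) for
   nu = mu + n a, and all the other components vanish.  Likewise
   [opF a n nu mu : M_nu -> M_mu].  This avoids transports along identities
   such as (mu + n b) + m a = (mu + m a) + n b.  The finite dimensionality in
   (X1) is built into [vectType]. *)
Record gradedSpace := GradedSpace {
  space :> weight -> vectType K;
  opE : simpleRoot -> nat -> forall mu nu, 'Hom(space mu, space nu);
  opF : simpleRoot -> nat -> forall nu mu, 'Hom(space nu, space mu);
  opE_deg : forall a n mu nu, nu != mu + sroot a *+ n -> opE a n mu nu = 0;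
  opF_deg : forall a n nu mu, nu != mu + sroot a *+ n -> opF a n nu mu = 0;
  opE0 : forall a mu, opE a 0 mu mu = \1%VF;
  opF0 : forall a mu, opF a 0 mu mu = \1%VF }.

Implicit Types (M N : gradedSpace) (mu nu la : weight) (a b : simpleRoot).

Definition gsupport M : set weight :=
  [set mu | \dim {: M mu} != 0%N]%classic.

Definition axiomX1 M : Prop := quasi_bounded Pi (gsupport M).

(* In the sum over r in Z, the terms with r < 0 vanish because of the quantum
   binomial, and those with r > min(m, n) because E and F vanish in negative
   degree. *)
Definition axiomX2 M : Prop :=
  forall mu a b (m n : nat), (0 < m)%N -> (0 < n)%N ->
  forall x : M (mu + sroot b *+ n),
  (a != b ->
     opE M a m mu (mu + sroot a *+ m) (opF M b n (mu + sroot b *+ n) mu x) =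
     let nu := mu + sroot b *+ n + sroot a *+ m in
     opF M b n nu (mu + sroot a *+ m) (opE M a m (mu + sroot b *+ n) nu x)) /\
  (a = b ->
     opE M a m mu (mu + sroot a *+ m) (opF M b n (mu + sroot b *+ n) mu x) =
     \sum_(0 <= r < (minn m n).+1)
        specialize q (qbin qv (pairing mu a + m%:Z + n%:Z) r%:Z) *:
        let nu := mu + sroot b *+ n + sroot a *+ (m - r) in
        opF M a (n - r) nu (mu + sroot a *+ m)
          (opE M a (m - r) (mu + sroot b *+ n) nu x)).

Definition in_kerE M mu (x : M mu) : Prop :=
  forall a (n : nat), (0 < n)%N -> opE M a n mu (mu + sroot a *+ n) x = 0.

(* The finitely supported families (y a n) with 0 < n < k, for some k, are the
   elements of the direct sum M_(delta mu). *)
Definition in_imF M mu (x : M mu) : Prop :=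
  exists (k : nat) (y : forall a (n : nat), M (mu + sroot a *+ n)),
    x = \sum_a \sum_(1 <= n < k) opF M a n (mu + sroot a *+ n) mu (y a n).

Definition axiomX3 M : Prop :=
  forall mu,
    (forall x : M mu, exists y z, [/\ in_kerE y, in_imF z & x = y + z]) /\
    (forall x : M mu, in_kerE x -> in_imF x -> x = 0).

Record Xob := XOb {
  Xspace :> gradedSpace;
  X1 : axiomX1 Xspace;
  X2 : axiomX2 Xspace;
  X3 : axiomX3 Xspace }.

Record Xhom (M N : Xob) := XHom {
  Xmap :> forall mu, 'Hom(M mu, N mu);
  XmapE : forall a n mu nu,
    (Xmap nu \o opE M a n mu nu)%VF = (opE N a n mu nu \o Xmap mu)%VF;
  XmapF : forall a n nu mu,
    (Xmap mu \o opF M a n nu mu)%VF = (opF N a n nu mu \o Xmap nu)%VF }.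

Lemma XhomP (M N : Xob) (f g : Xhom M N) : (forall mu, f mu = g mu) -> f = g.
Proof.
case: f g => [f fE fF] [g gE gF] /= fg.
have {}fg : f = g by apply: functional_extensionality_dep.
by subst g; congr XHom; exact: Prop_irrelevance.
Qed.

Program Definition Xid (M : Xob) : Xhom M M :=
  @XHom M M (fun mu => \1%VF) _ _.
Next Obligation. by move=> *; rewrite comp_lfun1l comp_lfun1r. Qed.
Next Obligation. by move=> *; rewrite comp_lfun1l comp_lfun1r. Qed.

Program Definition Xcomp (M N P : Xob) (f : Xhom N P) (g : Xhom M N) :
  Xhom M P := @XHom M P (fun mu => (f mu \o g mu)%VF) _ _.
Next Obligation.
by move=> *; rewrite -comp_lfunA XmapE comp_lfunA XmapE -comp_lfunA.
Qed.
Next Obligation.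
by move=> *; rewrite -comp_lfunA XmapF comp_lfunA XmapF -comp_lfunA.
Qed.

Program Definition catX : category :=
  @Category Xob Xhom Xid Xcomp _ _ _.
Next Obligation. by move=> *; apply: XhomP => mu /=; rewrite comp_lfun1l. Qed.
Next Obligation. by move=> *; apply: XhomP => mu /=; rewrite comp_lfun1r. Qed.
Next Obligation. by move=> *; apply: XhomP => mu /=; rewrite comp_lfunA. Qed.

Definition is_zero (M : Xob) : Prop := forall mu, \dim {: M mu} = 0%N.

(* The biproduct diagram exhibiting M as (isomorphic to) A (+) B. *)
Definition is_direct_sum (M A B : Xob) : Prop :=
  exists (i : Xhom A M) (j : Xhom B M) (p : Xhom M A) (r : Xhom M B),
  forall mu,
    [/\ (p mu \o i mu)%VF = \1%VF, (r mu \o j mu)%VF = \1%VF,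
        (p mu \o j mu)%VF = 0, (r mu \o i mu)%VF = 0
      & (i mu \o p mu)%VF + (j mu \o r mu)%VF = \1%VF].

Definition indecomposable (M : Xob) : Prop :=
  ~ is_zero M /\
  forall A B : Xob, is_direct_sum M A B -> is_zero A \/ is_zero B.

(* The properties characterizing S_(K,q)(la) up to isomorphism. *)
Definition is_S (la : weight) (M : Xob) : Prop :=
  [/\ indecomposable M, \dim {: M la} = 1%N
    & forall mu, \dim {: M mu} != 0%N -> wle Pi mu la].

End CategoryX.

(* Main.v *)
Require Import Defs.
From HB Require Import structures.
From mathcomp Require Import all_boot all_order all_algebra.
From mathcomp Require Import boolp classical_sets cardinality.
From mathcomp Require Import ring zify.

(**
Why the functor exists.  It moves the space M_mu to the weight l mu, lets
E_(l n) and F_(l n) act there as E_n and F_n up to a sign, and lets all the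
other operators vanish.  The axioms of M carry over; the one that needs an
argument about q is the commutation relation between E_(a, m) and F_(a, n),
where quantum binomials at multiples of l have to be compared with ordinary
ones.  This is the quantum Lucas theorem: if l is the quantum characteristic, then
[l k, r] = 0 when l does not divide r ([gbin_l_ndvd]), and
[l k, l b] = eps ^ (b (k - b)) C(k, b) with eps = q ^ (l ^ 2) = 1 or -1
([gbin_lucas]).  Both come from Pascal's rule with step l instead of step 1
([gbin_addl]), whose middle terms disappear because [l, j] = 0 for 0 < j < l;
step l is the q-Vandermonde identity.

When eps = -1, which happens for q = -1 in odd characteristic, the signs in
the relation are absorbed by rescaling the operators by powers of eps.  The
exponents ([twistE], [twistF]) are quadratic in n and linear in the weight
along the simple roots.  The relation for a = b fixes the sum of the linear
parts for E_a and F_a, namely <mu, a^vee>; the vanishing of the commutators of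
E_a and F_b forces the part for E_a at b and the part for F_b at a to agree.
An ordering of the simple roots solves both conditions as soon as the Cartan
matrix is symmetric modulo 2.  In the simply laced case this amounts to
<a, b^vee> = 0 iff <b, a^vee> = 0, which holds because the root system is
finite ([pairing_sym0]).

Why the functor sends S(la) to S(l la).  Indecomposability is replaced by a
condition which visibly survives the functor: M is one-dimensional at la, lives
below la, and M_mu = im F_mu for all mu different from la ([generated_below]).
The tool is an extension principle ([min_extension]): every linear map
M_la -> N_la between objects that live below la extends to a morphism with image
in im F_mu for mu different from la.  It is built downwards from la: once f is
known above mu, f(v) has to be the element y of im F_mu with E y = f (E v); by
(X3) there is at most one, and the commutation relations show that
y = F f(x) works for v = F x.  The same argument shows that such an extension is
unique ([Xhom_uniq]).  Hence the extension of the identity of M_la is an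
idempotent e; if M is indecomposable then e is the identity, so that M satisfies
the condition ([is_S_generated]).  Conversely any two objects satisfying it
are isomorphic, since the extensions of two inverse maps between the highest
weight spaces are inverse to each other ([generated_below_iso]).
*)

Set Implicit Arguments.
Unset Strict Implicit.
Unset Printing Implicit Defensive.

Import Order.TTheory GRing.Theory Num.Theory.
Local Open Scope ring_scope.

(** * Quantum binomials over a field *)

(** For statements whose truth at a and at a + 1 are tied by an invertible
    recursion, such as Pascal's rule in the upper argument. *)
Lemma int_step_ind (P : int -> Prop) :
  P 0 -> (forall a, P a <-> P (a + 1)) -> forall a, P a.
Proof.
move=> P0 PS; elim/int_rec => // n; first by rewrite -[n.+1]addn1 PoszD => /PS.
by move=> Pn; apply/PS; rewrite -[n.+1]addn1 PoszD opprD addrNK.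
Qed.

Fact sqr1_neq0 (K : fieldType) (eps : K) : eps * eps = 1 -> eps != 0.
Proof. by apply: contra_eq_neq => ->; rewrite mul0r eq_sym oner_neq0. Qed.

Lemma expz_mod2 (K : fieldType) (eps : K) (z w : int) :
  eps * eps = 1 -> (exists y, z = w + y * 2) -> eps ^ z = eps ^ w.
Proof.
move=> eps2 [y ->]; rewrite expfzDr ?sqr1_neq0 // [y * 2]mulrC -exprz_exp.
by rewrite -[eps ^ 2]/(eps * eps) eps2 exp1rz mulr1.
Qed.

Section GenericBinomial.
Variables (T : fieldType) (v : T).
Hypothesis v_neq0 : v != 0.
Hypothesis qint_neq0 : forall n : nat, (0 < n)%N -> qint v n%:Z != 0.

Lemma qbin_neg a n : qbin v a (Negz n) = 0.
Proof. by []. Qed.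

Lemma qbin0 a : qbin v a 0 = 1.
Proof. by rewrite -[0]/(Posz 0) /qbin !big_geq // divr1. Qed.

Lemma qbin0S k : qbin v 0 k.+1%:Z = 0.
Proof.
rewrite /qbin big_nat_recl //= -!mulrA {1}/qint -[Posz 0]/(0 : int).
by rewrite subr0 oppr0 subrr mul0r.
Qed.

Fact mulf_cancel_denom (x y z t : T) :
  x != 0 -> x * (y * z / (t * x)) = y * (z / t).
Proof.
by move=> x0; rewrite invfM [x * _]mulrC -!mulrA mulVf // mulr1.
Qed.

Lemma qbinS (a : int) (k : nat) :
  qint v k.+1%:Z * qbin v a k.+1%:Z = qint v (a - k%:Z) * qbin v a k%:Z.
Proof.
rewrite /qbin big_nat_recr //= [in X in _ / X]big_nat_recr //=.
by rewrite [X in X / _]mulrC mulf_cancel_denom ?qint_neq0.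
Qed.

(** The products over i of [a + 1 - i] and of [a - i] share all their factors
    but one. *)
Lemma qbinSS (a : int) (k : nat) :
  qint v k.+1%:Z * qbin v (a + 1) k.+1%:Z = qint v (a + 1) * qbin v a k%:Z.
Proof.
rewrite /qbin big_nat_recl //= subr0 [in X in _ / X]big_nat_recr //=.
have -> : \prod_(0 <= i < k) qint v (a + 1 - i.+1%:Z) =
    \prod_(0 <= i < k) qint v (a - i%:Z).
  by apply: eq_bigr => i _; congr qint; lia.
by rewrite mulf_cancel_denom ?qint_neq0.
Qed.

Lemma qint_add (a b : int) :
  qint v (a + b) = v ^ b * qint v a + v ^ (- a) * qint v b.
Proof.
rewrite /qint opprD !mulrA -mulrDl; congr (_ / _).
by rewrite !mulrBr -!expfzDr // [b + a]addrC [b - a]addrC subrKA.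
Qed.

Lemma qint_addV (a b : int) :
  qint v (a + b) = v ^ (- b) * qint v a + v ^ a * qint v b.
Proof. by rewrite [a + b]addrC qint_add addrC. Qed.

(** After multiplication by [b] both terms on the right are multiples of (a
    choose b - 1), with the factors v^b [a - b + 1] and v^(b - 1 - a) [b] whose
    sum is [a + 1]. Allowing b to be negative avoids boundary cases in the sums
    below. *)
Lemma qbin_pascal (a b : int) :
  qbin v (a + 1) b = v ^ b * qbin v a b + v ^ (b - 1 - a) * qbin v a (b - 1).
Proof.
case: b => [[|k]|n]; last 1 first.
- by rewrite (_ : Negz n - 1 = Negz n.+1) ?qbin_neg ?mulr0 ?addr0 //; lia.
- by rewrite !qbin0 (_ : 0 - 1 = Negz 0) // qbin_neg expr0z mulr0 mulr1 addr0.
have h := qint_neq0 (ltn0Sn k); apply: (mulfI h).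
rewrite qbinSS mulrDr [X in _ = X + _]mulrCA qbinS.
have -> : k.+1%:Z - 1 = k by lia.
have -> : a + 1 = (a - k%:Z) + k.+1%:Z by lia.
rewrite qint_add opprB mulrDl; congr (_ + _); ring.
Qed.

(** Pascal's rule with v replaced by its inverse, under which quantum binomials
    are invariant. *)
Lemma qbin_pascalV (a b : int) :
  qbin v (a + 1) b =
  v ^ (- b) * qbin v a b + v ^ (a + 1 - b) * qbin v a (b - 1).
Proof.
case: b => [[|k]|n]; last 1 first.
- by rewrite (_ : Negz n - 1 = Negz n.+1) ?qbin_neg ?mulr0 ?addr0 //; lia.
- by rewrite !qbin0 (_ : 0 - 1 = Negz 0) // qbin_neg expr0z mulr0 mulr1 addr0.
have h := qint_neq0 (ltn0Sn k); apply: (mulfI h).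
rewrite qbinSS mulrDr [X in _ = X + _]mulrCA qbinS.
have -> : k.+1%:Z - 1 = k by lia.
have -> : a + 1 - k.+1%:Z = a - k%:Z by lia.
have -> : a + 1 = (a - k%:Z) + k.+1%:Z by lia.
rewrite qint_addV mulrDl; congr (_ + _); ring.
Qed.

End GenericBinomial.

(** * Specialization of Laurent polynomials *)

(** The domain on which [specialize] is a ring morphism. *)
Definition is_laurent (f : {fraction {poly int}}) : Prop :=
  exists (p : {poly int}) (k : nat),
    f = @FracField.tofrac {poly int} p / qv ^+ k.

Lemma laurentD f g : is_laurent f -> is_laurent g -> is_laurent (f + g).
Proof.
move=> [p [k ->]] [s [m ->]]; exists (p * 'X^m + s * 'X^k), (k + m)%N.
rewrite rmorphD !rmorphM !rmorphXn /= -/qv exprD.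
by rewrite addf_div ?expf_neq0 ?qv_neq0.
Qed.

Lemma laurentM f g : is_laurent f -> is_laurent g -> is_laurent (f * g).
Proof.
move=> [p [k ->]] [s [m ->]]; exists (p * s), (k + m)%N.
by rewrite rmorphM exprD mulf_div.
Qed.

Lemma laurent_qvX (z : int) : is_laurent (qv ^ z).
Proof.
case: z => n; first by exists 'X^n, 0%N; rewrite expr0 divr1 rmorphXn.
by exists 1, n.+1; rewrite rmorph1 mul1r.
Qed.

Lemma laurent0 : is_laurent 0.
Proof. by exists 0, 0%N; rewrite rmorph0 mul0r. Qed.

Lemma laurentN f : is_laurent f -> is_laurent (- f).
Proof. by move=> [p [k ->]]; exists (- p), k; rewrite rmorphN mulNr. Qed.

Section Specialize.
Variables (K : fieldType) (q : K).
Hypothesis q_neq0 : q != 0.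

Lemma specializeD f g : is_laurent f -> is_laurent g ->
  specialize q (f + g) = specialize q f + specialize q g.
Proof.
move=> [p [k ->]] [s [m ->]]; rewrite addf_div ?expf_neq0 ?qv_neq0 //.
have -> : @FracField.tofrac {poly int} p * qv ^+ m
    + @FracField.tofrac {poly int} s * qv ^+ k =
    @FracField.tofrac {poly int} (p * 'X^m + s * 'X^k).
  by rewrite rmorphD !rmorphM !rmorphXn.
rewrite -exprD !specialize_frac // rmorphD !rmorphM /= !map_polyXn.
by rewrite hornerD !hornerM !hornerXn addf_div ?expf_neq0 // exprD.
Qed.

Lemma specializeM f g : is_laurent f -> is_laurent g ->
  specialize q (f * g) = specialize q f * specialize q g.
Proof.
move=> [p [k ->]] [s [m ->]]; rewrite mulf_div -exprD -rmorphM.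
by rewrite !specialize_frac // rmorphM /= hornerM exprD mulf_div.
Qed.

Lemma specializeX (z : int) : specialize q (qv ^ z) = q ^ z.
Proof.
case: z => n.
  rewrite -exprnP -[qv ^+ n]divr1 -[X in _ / X](expr0 qv) /qv -rmorphXn.
  by rewrite -/qv specialize_frac // map_polyXn hornerXn expr0 divr1.
rewrite -[qv ^ _]mul1r -[X in X * _](rmorph1 (@FracField.tofrac _)).
by rewrite specialize_frac // rmorph1 hornerC mul1r.
Qed.

Lemma specialize0 : specialize q 0 = 0.
Proof.
rewrite -[0](mul0r (qv ^+ 0)^-1) -(rmorph0 (@FracField.tofrac _)).
by rewrite specialize_frac // rmorph0 horner0 mul0r.
Qed.

Lemma specializeN f : is_laurent f -> specialize q (- f) = - specialize q f.
Proof.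
move=> Lf; apply/eqP; rewrite eq_sym eqr_oppLR -subr_eq0 opprK addrC.
by rewrite -specializeD // ?addNr ?specialize0 //; exact: laurentN.
Qed.

End Specialize.

(** The variable is not a root of unity, so quantum integers do not vanish
    before specialization. *)
Lemma qv_int_inj : injective (fun z : int => qv ^ z).
Proof.
have H (n : nat) : qv ^+ n = 1 -> n = 0%N.
  rewrite /qv -rmorphXn -(rmorph1 (@FracField.tofrac _)) => /eqP.
  rewrite tofrac_eq => /eqP /(congr1 (fun p : {poly int} => size p)).
  by rewrite size_polyXn size_poly1 => -[].
have H' (z : int) : qv ^ z = 1 -> z = 0.
  case: z => n; first by move/H ->.
  by rewrite NegzE -exprnN => /eqP; rewrite invr_eq1 => /eqP /H.
move=> a b /= ab; apply/eqP; rewrite -subr_eq0; apply/eqP/H'.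
by rewrite expfzDr ?qv_neq0 // ab -expfzDr ?qv_neq0 // subrr.
Qed.

Lemma qv_sub_neq0 : qv - qv^-1 != 0.
Proof.
rewrite subr_eq0 -[qv^-1]/(qv ^ -1) -[X in X == _]expr1z.
by apply/eqP => /qv_int_inj.
Qed.

Lemma qint_qv_neq0 (n : nat) : (0 < n)%N -> qint qv n%:Z != 0.
Proof.
move=> n0; have d0 : (qv - qv^-1)^-1 != 0 by rewrite invr_eq0 qv_sub_neq0.
apply: mulf_neq0 d0; rewrite subr_eq0; apply/eqP => /qv_int_inj.
by lia.
Qed.

Lemma qint_qvS (n : nat) :
  qint qv n.+1%:Z = qv ^ n%:Z + qv ^ (-1) * qint qv n%:Z.
Proof.
rewrite -addn1 PoszD qint_addV ?qv_neq0 // addrC.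
by rewrite [qint _ 1]mulfV ?qv_sub_neq0 // mulr1.
Qed.

Lemma laurent_qint (n : nat) : is_laurent (qint qv n%:Z).
Proof.
elim: n => [|n IHn].
  by rewrite /qint subrr mul0r; exact: laurent0.
rewrite qint_qvS; apply: laurentD; first exact: laurent_qvX.
by apply: laurentM IHn; exact: laurent_qvX.
Qed.

(** Induction on b; for given b, Pascal's rule leads from a to a + 1, and also
    from a + 1 to a because the coefficient v^b is a unit. *)
Lemma laurent_qbin (a b : int) : is_laurent (qbin qv a b).
Proof.
case: b => [k|n]; last by exact: laurent0.
have pasc := qbin_pascal qv_neq0 qint_qv_neq0.
elim: k a => [|k IHk]; first by move=> a; rewrite qbin0; exact: (laurent_qvX 0).
elim/int_step_ind => [|a]; first by rewrite qbin0S; exact: laurent0.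
have L : is_laurent (qv ^ (k.+1%:Z - 1 - a) * qbin qv a (k.+1%:Z - 1)).
  apply: laurentM; first exact: laurent_qvX.
  by have -> : k.+1%:Z - 1 = k by lia.
split=> [La|].
  by rewrite pasc; apply: laurentD L; apply: laurentM La; exact: laurent_qvX.
move/laurentD/(_ (laurentN L)); rewrite pasc addrK => La.
rewrite -[qbin _ _ _](mulKf (_ : qv ^ k.+1%:Z != 0)) ?expfz_neq0 ?qv_neq0 //.
by apply: laurentM La; rewrite invr_expz; exact: laurent_qvX.
Qed.

Section Gauss.
Variables (K : fieldType) (q : K).
Hypothesis q_neq0 : q != 0.

Definition gbin (a b : int) : K := specialize q (qbin qv a b).

Lemma gbin_neg (a : int) (n : nat) : gbin a (Negz n) = 0.
Proof. exact: specialize0. Qed.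

Lemma gbin0 (a : int) : gbin a 0 = 1.
Proof. by rewrite /gbin qbin0 -(expr0z qv) specializeX. Qed.

Lemma gbin0S (n : nat) : gbin 0 n.+1%:Z = 0.
Proof. by rewrite /gbin qbin0S specialize0. Qed.

Lemma gbin_pascal (a b : int) :
  gbin (a + 1) b = q ^ b * gbin a b + q ^ (b - 1 - a) * gbin a (b - 1).
Proof.
have L := laurent_qbin; have LX := laurent_qvX.
rewrite /gbin (qbin_pascal qv_neq0 qint_qv_neq0).
rewrite specializeD //; try exact: laurentM.
by rewrite !specializeM // !specializeX.
Qed.

Lemma gbin_pascalV (a b : int) :
  gbin (a + 1) b = q ^ (- b) * gbin a b + q ^ (a + 1 - b) * gbin a (b - 1).
Proof.
have L := laurent_qbin; have LX := laurent_qvX.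
rewrite /gbin (qbin_pascalV qv_neq0 qint_qv_neq0).
rewrite specializeD //; try exact: laurentM.
by rewrite !specializeM // !specializeX.
Qed.

Lemma gbin_small (n k : nat) : (n < k)%N -> gbin n%:Z k%:Z = 0.
Proof.
elim: n k => [|n IHn] [|k] // nk; first exact: gbin0S.
rewrite -addn1 PoszD gbin_pascal (_ : k.+1%:Z - 1 = k%:Z); last by lia.
by rewrite !IHn ?mulr0 ?addr0 // ltnW.
Qed.

Lemma gbinnn (n : nat) : gbin n%:Z n%:Z = 1.
Proof.
elim: n => [|n IHn]; first exact: gbin0.
rewrite -addn1 PoszD gbin_pascal addrK IHn -PoszD gbin_small ?addn1 //.
by rewrite subrr mulr0 add0r expr0z mulr1.
Qed.

(** Iterating Pascal's rule c times. The induction step expands (a + 1 choose _)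
    by one form of Pascal's rule and reassembles (c + 1 choose j) by the other. *)
Lemma gbin_vandermonde (c : nat) (a r : int) :
  gbin (a + c%:Z) r = \sum_(0 <= j < c.+1)
    q ^ ((c%:Z - j%:Z) * (r - j%:Z) - j%:Z * (a - r + j%:Z))
      * gbin c%:Z j%:Z * gbin a (r - j%:Z).
Proof.
elim: c a r => [|c IHc] a r.
  rewrite big_nat1 -[Posz 0]/(0 : int) gbin0.
  by rewrite !(subr0, mul0r, expr0z, mul1r, addr0).
have -> : a + c.+1%:Z = (a + 1) + c%:Z by lia.
rewrite {}IHc.
under eq_bigr => j _ do rewrite gbin_pascal mulrDr.
rewrite big_split /=.
under [in RHS]eq_bigr => j _ do
  rewrite -[in gbin c.+1%:Z _]addn1 PoszD gbin_pascalV mulrDr mulrDl.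
rewrite [in RHS]big_split /= [X in _ = X + _]big_nat_recr //=.
rewrite gbin_small // mulr0 mulr0 mul0r addr0.
rewrite [X in _ = _ + X]big_nat_recl //= (gbin_neg _ 0) !mulr0 mul0r add0r.
congr (_ + _); apply: eq_bigr => j _.
  rewrite mulrACA -expfzDr // mulrA [in RHS]mulrA -expfzDr //.
  congr (_ ^ _ * _ * _); rewrite -addn1 PoszD; ring.
have -> : j.+1%:Z - 1 = j%:Z by lia.
have -> : r - j.+1%:Z = r - j%:Z - 1 by lia.
rewrite mulrACA -expfzDr // mulrA [in RHS]mulrA -expfzDr //.
congr (_ ^ _ * _ * _); rewrite -[c.+1]addn1 -[j.+1]addn1 !PoszD; ring.
Qed.

End Gauss.

(** * The quantum Lucas theorem *)

Section Lucas.
Variables (K : fieldType) (q : K) (l : nat).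
Hypothesis q_neq0 : q != 0.
Hypothesis l_gt0 : (0 < l)%N.
Hypothesis qint_l : specialize q (qint qv l%:Z) = 0.
Hypothesis qint_lt_l :
  forall k : nat, (0 < k < l)%N -> specialize q (qint qv k%:Z) != 0.

(** [j] (l choose j) = [l] (l - 1 choose j - 1), and only [l] vanishes in K. *)
Lemma gbin_l_eq0 (j : nat) : (0 < j < l)%N -> gbin q l%:Z j%:Z = 0.
Proof.
move=> jl; have [j0 lj] := andP jl.
apply/eqP; move: (qint_lt_l jl); apply: contraNT => g0.
rewrite -(mulIr_eq0 _ (mulIf g0)).
rewrite /gbin -specializeM //; [|exact: laurent_qint|exact: laurent_qbin].
have := qbinSS qv_neq0 qint_qv_neq0 (l%:Z - 1) j.-1.
rewrite prednK // subrK => ->.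
rewrite specializeM //; [|exact: laurent_qint|exact: laurent_qbin].
by rewrite qint_l mul0r.
Qed.

(** In the q-Vandermonde sum for a + l only the two extreme terms survive. *)
Lemma gbin_addl (a r : int) :
  gbin q (a + l%:Z) r = q ^ (l%:Z * r) * gbin q a r
    + q ^ (- (l%:Z * (a - r + l%:Z))) * gbin q a (r - l%:Z).
Proof.
rewrite gbin_vandermonde // big_nat_recr //= big_ltn // big_nat_cond big1 ?addr0.
  rewrite -[Posz 0]/(0 : int) gbin0 // gbinnn // subrr.
  by rewrite !(subr0, mul0r, sub0r, mulr1).
by move=> i; rewrite andbT => /gbin_l_eq0 ->; rewrite mulr0 mul0r.
Qed.

(** Strong induction on r: the second term of [gbin_addl] vanishes by induction,
    so the binomials for consecutive k differ by a unit, and for k = 0 the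
    binomial is 0. *)
Lemma gbin_l_ndvd (k : int) (r : nat) :
  ~~ (l %| r)%N -> gbin q (l%:Z * k) r%:Z = 0.
Proof.
elim/ltn_ind: r k => r IHr k nlr.
have r0 : (0 < r)%N by case: r nlr {IHr} => //; rewrite dvdn0.
have step a : gbin q (l%:Z * (a + 1)) r%:Z =
    q ^ (l%:Z * r%:Z) * gbin q (l%:Z * a) r%:Z.
  rewrite mulrDr mulr1 gbin_addl; have [lr|rl] := leqP l r.
    have nlrl : ~~ (l %| r - l)%N.
      by apply: contra nlr => /dvdn_add/(_ (dvdnn l)); rewrite subnK.
    by rewrite subzn // (IHr (r - l)%N) ?mulr0 ?addr0 // ltn_subrL l_gt0.
  have -> : r%:Z - l%:Z = Negz (l - r).-1 by lia.
  by rewrite gbin_neg // mulr0 addr0.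
elim/int_step_ind: k => [|a].
  by rewrite mulr0 -(prednK r0) gbin0S.
rewrite step; split=> [->|/eqP]; first by rewrite mulr0.
by rewrite mulf_eq0 expfz_eq0 (negPf q_neq0) andbF => /eqP.
Qed.

(** The value of the parameter in the step-l Pascal rule restricted to multiples
    of l: quantum binomials at multiples of l are quantum binomials for the
    parameter q^(l^2). *)
Definition frob_sign : K := q ^+ (l * l).

(** From [l] = 0 one gets q^l = q^(-l). *)
Lemma frob_sign_sqr : frob_sign * frob_sign = 1.
Proof.
have ql2 : q ^+ l * q ^+ l = 1.
  have : (qv - qv^-1) * qint qv l%:Z = qv ^ l%:Z - qv ^ (- l%:Z).
    by rewrite mulrC divfK ?qv_sub_neq0.
  have LX := laurent_qvX; have Lv : is_laurent (qv - qv^-1).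
    by apply: laurentD; [exact: (LX 1) | apply: laurentN; exact: (LX (-1))].
  move/(congr1 (specialize q)).
  rewrite specializeM //; last exact: laurent_qint.
  rewrite qint_l mulr0 specializeD //; last exact: laurentN.
  rewrite specializeN // !specializeX // => /esym/eqP.
  rewrite subr_eq0 => /eqP e.
  by rewrite -[q ^+ l]/(q ^ l%:Z) {1}e -expfzDr // addNr.
by rewrite /frob_sign exprM -exprMn ql2 expr1n.
Qed.

(** Both sides satisfy the Pascal rule with parameter [frob_sign], and they
    agree for k = 0. *)
Lemma gbin_lucas (k : int) (b : nat) :
  gbin q (l%:Z * k) (l%:Z * b%:Z) =
  frob_sign ^ (b%:Z * (k - b%:Z)) * gbin 1 k b%:Z.
Proof.
have s0 : frob_sign != 0 by rewrite expf_neq0.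
have one0 : 1 != 0 :> K by exact: oner_neq0.
have qs (z : int) : q ^ (l%:Z * (l%:Z * z)) = frob_sign ^ z.
  by rewrite mulrA -exprz_exp.
have pascal1 (a : int) (n : nat) :
    gbin 1 (a + 1) n.+1%:Z = gbin 1 a n.+1%:Z + gbin 1 a n%:Z :> K.
  have := gbin_pascal one0 a n.+1%:Z; rewrite !exp1rz !mul1r => ->.
  by have -> : n.+1%:Z - 1 = n%:Z by lia.
elim: b k => [|b IHb] k; first by rewrite mulr0 mul0r !gbin0 ?oner_neq0 // mulr1.
have step a : gbin q (l%:Z * (a + 1)) (l%:Z * b.+1%:Z) =
    frob_sign ^ b.+1%:Z * gbin q (l%:Z * a) (l%:Z * b.+1%:Z)
    + frob_sign ^ ((b%:Z + 1) * (a - b%:Z)) * gbin 1 a b%:Z.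
  rewrite mulrDr mulr1 gbin_addl qs; congr (_ + _).
  have -> : l%:Z * b.+1%:Z - l%:Z = l%:Z * b%:Z by rewrite -addn1 PoszD; ring.
  rewrite IHb mulrA; congr (_ * _).
  have -> : - (l%:Z * (l%:Z * a - l%:Z * b.+1%:Z + l%:Z)) =
            l%:Z * (l%:Z * (b%:Z - a)) by rewrite -addn1 PoszD; ring.
  rewrite qs -expfzDr //; apply: (expz_mod2 frob_sign_sqr).
  exists (b%:Z - a); ring.
have step1 a :
    frob_sign ^ (b.+1%:Z * (a + 1 - b.+1%:Z)) * gbin 1 (a + 1) b.+1%:Z =
    frob_sign ^ b.+1%:Z
      * (frob_sign ^ (b.+1%:Z * (a - b.+1%:Z)) * gbin 1 a b.+1%:Z)
    + frob_sign ^ ((b%:Z + 1) * (a - b%:Z)) * gbin 1 a b%:Z.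
  rewrite pascal1 mulrDr mulrA -expfzDr //.
  congr (_ ^ _ * _ + _ ^ _ * _); rewrite -addn1 PoszD; ring.
elim/int_step_ind: k => [|a].
  rewrite mulr0 gbin0S ?oner_neq0 // mulr0.
  by rewrite -PoszM -(prednK (_ : 0 < l * b.+1)%N) ?muln_gt0 ?l_gt0 // gbin0S.
rewrite step step1; split=> [->|] //; move/addIr/mulfI; apply.
by rewrite expfz_neq0.
Qed.

End Lucas.

(** * Weights, heights and the Cartan matrix *)

Section RootData.
Variables (F : archiRealFieldType) (V : vectType F) (R : rootSystem V).
Variable Pi : rootBasis R.
Implicit Types (mu nu la : weight R) (a b c : simpleRoot Pi).

Lemma wvalD mu nu : wval (mu + nu) = wval mu + wval nu.
Proof. exact: (raddfD (\val : weight R -> V)). Qed.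

Lemma wvalN mu : wval (- mu) = - wval mu.
Proof. exact: (raddfN (\val : weight R -> V)). Qed.

Lemma wvalMn mu n : wval (mu *+ n) = wval mu *+ n.
Proof. exact: (raddfMn (\val : weight R -> V)). Qed.

Lemma pairingD mu nu a : pairing (mu + nu) a = pairing mu a + pairing nu a.
Proof.
by apply: (@intr_inj F); rewrite rmorphD /= !pairingE wvalD linearD.
Qed.

Lemma pairingMn mu n a : pairing (mu *+ n) a = pairing mu a * n%:Z.
Proof.
apply: (@intr_inj F).
by rewrite rmorphM /= !pairingE wvalMn linearMn /= mulr_natr.
Qed.

Lemma pairing_self a : pairing (sroot a) a = 2.
Proof.
apply: (@intr_inj F); rewrite pairingE coroot2 //.
exact: (simple_roots (ssvalP a)).
Qed.

Definition simpleCoord a : V -> F :=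
  coord (in_tuple (simple Pi))
    (Ordinal (etrans (index_mem (ssval a) (simple Pi)) (ssvalP a))).

Lemma simpleCoordE a b : simpleCoord a (wval (sroot b)) = (b == a)%:R.
Proof.
rewrite /simpleCoord /=.
have bS : (index (ssval b) (simple Pi) < size (simple Pi))%N.
  by rewrite index_mem ssvalP.
have -> : ssval b = (in_tuple (simple Pi))`_(Ordinal bS).
  by rewrite /= nth_index ?ssvalP.
rewrite coord_free ?simple_free // -val_eqE /=.
congr (nat_of_bool _)%:R.
apply/eqP/eqP => [e|->//]; apply: val_inj => /=.
by rewrite -[LHS](nth_index 0 (ssvalP b)) e nth_index ?ssvalP.
Qed.

Lemma simpleCoordD a : {morph simpleCoord a : x y / x + y}.
Proof. exact: linearD. Qed.
Lemma simpleCoordMn a n : {morph simpleCoord a : x / x *+ n}.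
Proof. exact: linearMn. Qed.
Lemma simpleCoordN a : {morph simpleCoord a : x / - x}.
Proof. exact: linearN. Qed.

Definition height (x : V) : F := \sum_a simpleCoord a x.

Lemma heightD : {morph height : x y / x + y}.
Proof.
by move=> x y; rewrite -big_split; apply: eq_bigr => a _; rewrite simpleCoordD.
Qed.

Lemma heightMn n : {morph height : x / x *+ n}.
Proof.
by move=> x; rewrite -sumrMnl; apply: eq_bigr => a _; rewrite simpleCoordMn.
Qed.

Lemma heightN : {morph height : x / - x}.
Proof.
by move=> x; rewrite -sumrN; apply: eq_bigr => a _; rewrite simpleCoordN.
Qed.

Lemma height_sroot a : height (wval (sroot a)) = 1.
Proof.
rewrite /height (bigD1 a) //= simpleCoordE eqxx big1 ?addr0 // => b ba.
by rewrite simpleCoordE eq_sym (negPf ba).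
Qed.

Lemma height_wle mu la : wle Pi mu la ->
  exists n : nat, height (wval la - wval mu) = n%:R.
Proof.
move=> [c e]; exists (\sum_a c a)%N; rewrite -wvalN -wvalD e natr_sum.
have -> : wval (\sum_a sroot a *+ c a) = \sum_a wval (sroot a *+ c a).
  exact: (raddf_sum (\val : weight R -> V)).
rewrite (big_morph _ heightD (id1 := 0)); last first.
  by rewrite /height big1 // => a _; rewrite /simpleCoord linear0.
by apply: eq_bigr => a _; rewrite wvalMn heightMn height_sroot.
Qed.

Lemma wle_mul mu la l : wle Pi mu la -> wle Pi (mu *+ l) (la *+ l).
Proof.
move=> [c e]; exists (fun b => (c b * l)%N).
by rewrite -mulrnBl e -sumrMnl; apply: eq_bigr => b _; rewrite mulrnA.
Qed.

Lemma not_wle_above la a n : (0 < n)%N -> ~ wle Pi (la + sroot a *+ n) la.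
Proof.
move=> n0 /height_wle [m]; rewrite wvalD opprD addrA subrr sub0r heightN wvalMn.
rewrite heightMn height_sroot => /eqP.
rewrite eq_sym -subr_eq0 opprK -natrD pnatr_eq0.
by rewrite addn_eq0 [n == 0%N]gtn_eqF ?andbF.
Qed.

(** A measure that drops along mu |-> mu + n a as long as the weight stays below
    la ([depth_lt]); it drives all the downward inductions from la. *)
Definition depth la mu : nat := Num.truncn (height (wval la - wval mu)).

Lemma depth_lt la mu a n : (0 < n)%N -> wle Pi (mu + sroot a *+ n) la ->
  (depth la (mu + sroot a *+ n)%R < depth la mu)%N.
Proof.
move=> n0 /height_wle [m e]; rewrite /depth e natrK.
have -> : height (wval la - wval mu) = (m + n)%:R.
  rewrite natrD -e wvalD opprD addrA [in RHS]heightD heightN wvalMn heightMn.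
  by rewrite height_sroot subrK.
by rewrite natrK -[X in (X < _)%N]addn0 ltn_add2l.
Qed.

(** If <b, a^vee> = 0 and c = <a, b^vee>, then the square of s_a s_b sends a to
    a + 2 c b, hence all a + 2 n c b are roots; finiteness forces c = 0. *)
Lemma pairing_sym0 a b : pairing (sroot b) a = 0 -> pairing (sroot a) b = 0.
Proof.
have aR := simple_roots (ssvalP a); have bR := simple_roots (ssvalP b).
move=> /(congr1 (intr : int -> F)); rewrite pairingE /= => ba.
apply: (@intr_inj F); rewrite pairingE /=; set c := coroot R (ssval b) (ssval a).
have refl2 (e t : F) : e *: ssval a + t *: ssval b \in Defs.roots R ->
    (- e) *: ssval a + (- (e * c) - t) *: ssval b \in Defs.roots R.
  move=> /(roots_refl bR); rewrite linearD !linearZ /= -/c (coroot2 bR).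
  set y := (X in X \in _) => /(roots_refl aR).
  have -> : y = e *: ssval a + (- (e * c) - t) *: ssval b.
    rewrite /y scalerN -addrA -scalerBl; congr (_ + _ *: _).
    by rewrite /GRing.scale /=; ring.
  rewrite linearD !linearZ /= ba (coroot2 aR) mulr0 addr0.
  rewrite scalerN addrAC -scalerBl; rewrite (_ : e - e * 2 = - e) //.
  by ring.
pose f (n : nat) : V := ssval a + (c *+ 2 *+ n) *: ssval b.
have fR n : f n \in Defs.roots R.
  rewrite /f; elim: n => [|n]; first by rewrite mulr0n scale0r addr0.
  rewrite -{1}[ssval a]scale1r => /refl2 /refl2; rewrite opprK scale1r.
  set u := (X in _ + X *: _); rewrite (_ : u = c *+ 2 *+ n.+1) //.
  by rewrite /u mulrS; ring.
apply/eqP; apply: contraT => c0.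
have b0 : ssval b != 0 by apply: contraNneq (roots_neq0 R) => <-.
have f_inj : injective f.
  move=> m n /addrI /eqP; rewrite -subr_eq0 -scalerBl scaler_eq0 (negPf b0) orbF.
  have c20 : c *+ 2 != 0 by rewrite mulrn_eq0.
  rewrite subr_eq0 -[_ *+ m]mulr_natr -[_ *+ n]mulr_natr.
  move=> /eqP /(mulfI c20) /eqP; by rewrite eqr_nat => /eqP.
have /uniq_leq_size : uniq [seq f n | n <- iota 0 (size (Defs.roots R)).+1].
  by rewrite map_inj_uniq // iota_uniq.
move/(_ (Defs.roots R)); rewrite size_map size_iota ltnn; apply.
by move=> x /mapP[n _ ->].
Qed.

Lemma simply_laced_pairing_sym a b : simply_laced Pi -> a != b ->
  pairing (sroot a) b = pairing (sroot b) a.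
Proof.
move=> sl ab; have ba : b != a by rewrite eq_sym.
case: (sl a b ab) => e; first by rewrite e (pairing_sym0 e).
case: (sl b a ba) => e'; last by rewrite e e'.
by rewrite (pairing_sym0 e') in e.
Qed.

End RootData.

(** * The operators of a graded space *)

Lemma dim0_eq0 (K : fieldType) (U : vectType K) (x : U) :
  \dim {: U} = 0%N -> x = 0.
Proof.
move/eqP; rewrite dimv_eq0 => /eqP U0; apply/eqP; rewrite -memv0 -U0.
exact: memvf.
Qed.

Lemma lfun_of_relation (K : fieldType) (U W : vectType K) (G : U -> W -> Prop) :
  (forall x, exists y, G x y) ->
  (forall c x x' y y', G x y -> G x' y' -> G (c *: x + x') (c *: y + y')) ->
  (forall x y y', G x y -> G x y' -> y = y') ->
  exists g : 'Hom(U, W), forall x, G x (g x).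
Proof.
move=> /choice[g0 gG] Glin Gfun.
have g_lin : linear g0 by move=> c x y; apply: Gfun (gG _) (Glin _ _ _ _ _ _ _).
pose g1 : {linear U -> W} := HB.pack g0 (GRing.isLinear.Build _ _ _ _ _ g_lin).
by exists (linfun g1) => x; rewrite lfunE; exact: gG.
Qed.

Section GradedSpace.
Variables (F : archiRealFieldType) (V : vectType F) (R : rootSystem V).
Variables (Pi : rootBasis R) (K : fieldType) (M : gradedSpace Pi K).
Implicit Types (mu nu la : weight R) (a b : simpleRoot Pi).

Lemma in_imF0 mu : in_imF (0 : M mu).
Proof.
exists 0%N, (fun _ _ => 0); rewrite big1 // => a _.
by rewrite big_geq.
Qed.

(** Families with bound k extended by zero to a larger bound, so that two
    elements of im F_mu can be written with the same bound. *)
Lemma in_imF_bound mu (k k' : nat)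
    (y : forall a (n : nat), M (mu + sroot a *+ n)) :
  (k <= k')%N -> exists y' : forall a (n : nat), M (mu + sroot a *+ n),
    \sum_a \sum_(1 <= n < k) opF M a n (mu + sroot a *+ n) mu (y a n) =
    \sum_a \sum_(1 <= n < k') opF M a n (mu + sroot a *+ n) mu (y' a n).
Proof.
move=> kk'; exists (fun a n => if (n < k)%N then y a n else 0).
apply: eq_bigr => a _; rewrite (big_nat_widen _ _ _ _ _ kk') [RHS]big_nat_cond.
rewrite [LHS]big_nat_cond [in LHS]big_mkcond [in RHS]big_mkcond /=.
apply: eq_bigr => n _; case: (1 <= n < k')%N => //=.
by case: ifP => //; rewrite linear0.
Qed.

Lemma in_imFD mu (x y : M mu) : in_imF x -> in_imF y -> in_imF (x + y).
Proof.
move=> [k [u ->]] [k' [w ->]].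
have [u' ->] := in_imF_bound u (leq_maxl k k').
have [w' ->] := in_imF_bound w (leq_maxr k k').
exists (maxn k k'), (fun a n => u' a n + w' a n).
rewrite -big_split; apply: eq_bigr => a _ /=; rewrite -big_split.
by apply: eq_bigr => n _; rewrite linearD.
Qed.

Lemma in_imFZ mu c (x : M mu) : in_imF x -> in_imF (c *: x).
Proof.
move=> [k [u ->]]; exists k, (fun a n => c *: u a n).
rewrite scaler_sumr; apply: eq_bigr => a _; rewrite scaler_sumr.
by apply: eq_bigr => n _; rewrite linearZ.
Qed.

(** The family concentrated in (a, n) needs x moved into the (b, m)-component
    for the purpose of typing; E_(a, 0), which is the identity at equal weights
    and zero elsewhere, does this without a transport. *)
Lemma in_imF_opF mu nu a n (x : M nu) : (0 < n)%N -> in_imF (opF M a n nu mu x).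
Proof.
move=> n0; have [e|/opF_deg ->] := eqVneq nu (mu + sroot a *+ n); last first.
  by rewrite zero_lfunE; exact: in_imF0.
subst nu; exists n.+1, (fun b m =>
  if (b == a) && (m == n) then opE M a 0 (mu + sroot a *+ n) (mu + sroot b *+ m) x
  else 0).
rewrite (bigD1 a) //= big_nat_recr //= !eqxx /= opE0 lfunE /=.
rewrite big_nat_cond big1 ?add0r ?big1 ?addr0 //.
  by move=> b /negPf ba; rewrite big1 // => m _; rewrite ba /= linear0.
by move=> m; rewrite andbT => /andP[_ mn]; rewrite (ltn_eqF mn) linear0.
Qed.

Lemma in_imF_ind mu (P : M mu -> Prop) :
  P 0 -> (forall x y, P x -> P y -> P (x + y)) ->
  (forall a n y, (0 < n)%N -> P (opF M a n (mu + sroot a *+ n) mu y)) ->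
  forall x, in_imF x -> P x.
Proof.
move=> P0 PD PF x [k [y ->]]; elim/big_ind: _ => // a _.
rewrite big_nat_cond; elim/big_ind: _ => // n; rewrite andbT => /andP[n0 _].
exact: PF.
Qed.

End GradedSpace.

Section CommutationRules.
Variables (F : archiRealFieldType) (V : vectType F) (R : rootSystem V).
Variables (Pi : rootBasis R) (K : fieldType) (q : K) (M : Xob Pi q).
Implicit Types (mu nu : weight R) (a b : simpleRoot Pi).

(** The commutation relations with free target weights, so that they rewrite
    expressions in which the weights are sums in a different order. *)
Lemma opEF_comm a b m n mu nu rho kap (x : M nu) :
  a != b -> (0 < m)%N -> (0 < n)%N ->
  nu = mu + sroot b *+ n -> rho = mu + sroot a *+ m -> kap = nu + sroot a *+ m ->
  opE M a m mu rho (opF M b n nu mu x) = opF M b n kap rho (opE M a m nu kap x).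
Proof.
by move=> ab m0 n0 enu -> ->; subst nu; have [h _] := X2 a m0 n0 x; exact: h.
Qed.

Lemma opEF_same a m n mu nu rho (x : M nu) :
  (0 < m)%N -> (0 < n)%N -> nu = mu + sroot a *+ n -> rho = mu + sroot a *+ m ->
  opE M a m mu rho (opF M a n nu mu x) =
  \sum_(0 <= r < (minn m n).+1)
    gbin q (pairing mu a + m%:Z + n%:Z) r%:Z *:
    opF M a (n - r) (nu + sroot a *+ (m - r)) rho
      (opE M a (m - r) nu (nu + sroot a *+ (m - r)) x).
Proof.
by move=> m0 n0 enu ->; subst nu; have [_ h] := X2 a m0 n0 x; exact: h.
Qed.

End CommutationRules.

(** * Extension of morphisms from the highest weight *)

Section Extension.
Variables (F : archiRealFieldType) (V : vectType F) (R : rootSystem V).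
Variables (Pi : rootBasis R) (K : fieldType) (q : K) (la : weight R).
Implicit Types (mu nu : weight R) (a b : simpleRoot Pi).

Definition bounded_by (M : gradedSpace Pi K) : Prop :=
  forall mu, \dim {: M mu} != 0%N -> wle Pi mu la.

Lemma bounded_by_eq0 (M : gradedSpace Pi K) mu (x : M mu) :
  bounded_by M -> ~ wle Pi mu la -> x = 0.
Proof.
move=> bM nle; apply: dim0_eq0; apply/eqP.
by apply: contra_notT nle; exact: bM.
Qed.

Lemma bounded_by_eq (M : gradedSpace Pi K) mu (x y : M mu) :
  bounded_by M -> ~ wle Pi mu la -> x = y.
Proof.
by move=> bM nle; rewrite (bounded_by_eq0 x bM nle) (bounded_by_eq0 y bM nle).
Qed.

(** ker E_mu and im F_mu meet in 0, by (X3). *)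
Lemma in_imF_kerE_uniq (M : Xob Pi q) mu (x y : M mu) :
  in_imF x -> in_imF y ->
  (forall a n, (0 < n)%N ->
     opE M a n mu (mu + sroot a *+ n) x = opE M a n mu (mu + sroot a *+ n) y) ->
  x = y.
Proof.
move=> Fx Fy Exy; apply/eqP; rewrite -subr_eq0; apply/eqP.
apply: (X3 M mu).2; first by move=> a n n0; rewrite linearB /= Exy ?subrr.
by rewrite -scaleN1r; apply: in_imFD Fx _; exact: in_imFZ.
Qed.

Variables (M N : Xob Pi q).
Hypotheses (bM : bounded_by M) (bN : bounded_by N).

Lemma Xhom_opE (f : Xhom M N) a n mu nu x :
  f nu (opE M a n mu nu x) = opE N a n mu nu (f mu x).
Proof. by have /lfunP/(_ x) := XmapE f a n mu nu; rewrite !lfunE. Qed.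

Lemma Xhom_opF (f : Xhom M N) a n nu mu x :
  f mu (opF M a n nu mu x) = opF N a n nu mu (f nu x).
Proof. by have /lfunP/(_ x) := XmapF f a n nu mu; rewrite !lfunE. Qed.

(** At mu different from la, f(x) is an element of im F_mu whose images under
    all E are determined by the values of f above mu. *)
Lemma Xhom_uniq (f g : Xhom M N) : f la = g la ->
  (forall mu x, mu != la -> in_imF (f mu x)) ->
  (forall mu x, mu != la -> in_imF (g mu x)) -> f = g.
Proof.
move=> fgla fF gF; apply: XhomP => mu.
have [d] := ubnP (depth Pi la mu).
elim: d mu => // d IHd mu; rewrite ltnS => le_d.
have [->//|mula] := eqVneq mu la; apply/lfunP => x.
apply: in_imF_kerE_uniq; [exact: fF | exact: gF |] => a n n0.
rewrite -!Xhom_opE.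
have [le|nle] := pselect (wle Pi (mu + sroot a *+ n) la); last first.
  by rewrite [opE _ _ _ _ _ _](bounded_by_eq0 _ bM nle) !linear0.
by rewrite IHd // (leq_trans _ le_d) // depth_lt.
Qed.

Variable phi : forall mu, 'Hom(M mu, N mu).
Implicit Types (f : forall mu, 'Hom(M mu, N mu)).

(** The condition that determines the value y of the extension at x once the
    extension is known above mu. It refers to f only at the weights mu + n a
    with n > 0. *)
Definition min_extends f mu (x : M mu) (y : N mu) : Prop :=
  in_imF y /\ forall a n, (0 < n)%N ->
    opE N a n mu (mu + sroot a *+ n) y =
    f (mu + sroot a *+ n) (opE M a n mu (mu + sroot a *+ n) x).

(** The extension is a fixed point of this operation, which computes the values
    at mu from those at smaller depth. *)
Definition extension_step f mu : 'Hom(M mu, N mu) :=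
  if mu == la then phi mu
  else xget 0 [set g | forall x, min_extends f x (fun_of_lfun g x)]%classic.

Lemma extension_step_local f g mu :
  (forall nu, (depth Pi la nu < depth Pi la mu)%N -> f nu = g nu) ->
  extension_step f mu = extension_step g mu.
Proof.
move=> fg; rewrite /extension_step; case: ifP => // _; congr xget.
have E a n x : (0 < n)%N ->
    f (mu + sroot a *+ n) (opE M a n mu (mu + sroot a *+ n) x) =
    g (mu + sroot a *+ n) (opE M a n mu (mu + sroot a *+ n) x).
  move=> n0; have [le|nle] := pselect (wle Pi (mu + sroot a *+ n) la).
    by rewrite fg // depth_lt.
  by rewrite [opE _ _ _ _ _ _](bounded_by_eq0 _ bM nle) !linear0.
by apply/predeqP => h; split=> hf x; have [? hE] := hf x; split=> // a n n0;
  rewrite hE // E.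
Qed.

(** The value at mu is stable after depth(mu) + 1 rounds
    ([iter_extension_step]). *)
Definition extension mu := iter (depth Pi la mu).+1 extension_step (fun=> 0) mu.

Lemma iter_extension_step k mu : (depth Pi la mu < k)%N ->
  iter k extension_step (fun=> 0) mu = extension mu.
Proof.
have [d] := ubnP (depth Pi la mu); elim: d k mu => // d IHd [//|k] mu.
rewrite !ltnS => le_d le_k; rewrite /extension !iterS.
apply: extension_step_local => nu lt.
have ltd := leq_trans lt le_d.
by rewrite !IHd // (leq_trans lt).
Qed.

Lemma extensionE mu : extension mu = extension_step extension mu.
Proof.
rewrite /extension iterS; apply: extension_step_local => nu lt.
by rewrite iter_extension_step.
Qed.

(** The commutation of the extension with the operators that start (E) or end
    (F) at mu. *)
Definition commutes_at mu : Prop :=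
  (forall a n nu (x : M mu),
     extension nu (opE M a n mu nu x) = opE N a n mu nu (extension mu x)) /\
  (forall a n nu (x : M nu),
     extension mu (opF M a n nu mu x) = opF N a n nu mu (extension nu x)).

Lemma commutes_at_pos mu :
  (forall a n, (0 < n)%N ->
    (forall x,
       extension (mu + sroot a *+ n) (opE M a n mu (mu + sroot a *+ n) x) =
       opE N a n mu (mu + sroot a *+ n) (extension mu x)) /\
    (forall x, extension mu (opF M a n (mu + sroot a *+ n) mu x) =
       opF N a n (mu + sroot a *+ n) mu (extension _ x))) ->
  commutes_at mu.
Proof.
move=> pos; split=> a [|n] nu x.
- have [e|ne] := eqVneq nu (mu + sroot a *+ 0).
    by rewrite mulr0n addr0 in e; subst nu; rewrite !opE0 !id_lfunE.
  by rewrite !opE_deg // !zero_lfunE linear0.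
- have [->|ne] := eqVneq nu (mu + sroot a *+ n.+1).
    by have [E _] := pos a n.+1 (ltn0Sn n); exact: E.
  by rewrite !opE_deg // !zero_lfunE linear0.
- have [e|ne] := eqVneq nu (mu + sroot a *+ 0).
    by rewrite mulr0n addr0 in e; subst nu; rewrite !opF0 !id_lfunE.
  by rewrite !opF_deg // !zero_lfunE linear0.
- have [e|ne] := eqVneq nu (mu + sroot a *+ n.+1).
    by subst nu; have [_ E] := pos a n.+1 (ltn0Sn n); exact: E.
  by rewrite !opF_deg // !zero_lfunE linear0.
Qed.

Lemma min_extends_uniq f mu (x : M mu) y z :
  min_extends f x y -> min_extends f x z -> y = z.
Proof.
move=> [Fy Ey] [Fz Ez]; apply: in_imF_kerE_uniq => // a n n0.
by rewrite Ey // Ez.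
Qed.

(** This is where (X2) enters: E F x is a combination of terms F E x with the
    same coefficients in M and in N, and in those terms the extension is only
    applied above mu, where it already commutes. *)
Lemma min_extends_opF mu a n (x : M (mu + sroot a *+ n)) :
  (forall b m, (0 < m)%N -> commutes_at (mu + sroot b *+ m)) -> (0 < n)%N ->
  min_extends extension (opF M a n (mu + sroot a *+ n) mu x)
    (opF N a n (mu + sroot a *+ n) mu (extension _ x)).
Proof.
move=> comm n0; split=> [|b m m0]; first exact: in_imF_opF.
have [cE _] := comm a n n0; have [_ cF] := comm b m m0.
have [->|ba] := eqVneq b a.
  have [_ cFa] := comm a m m0.
  rewrite (opEF_same (M := N)) // (opEF_same (M := M)) // linear_sum.
  by apply: eq_bigr => r _; rewrite linearZ /= cFa cE.
rewrite (opEF_comm (M := N) (kap := mu + sroot a *+ n + sroot b *+ m)) //.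
rewrite (opEF_comm (M := M) (kap := mu + sroot a *+ n + sroot b *+ m)) //.
by rewrite cF cE.
Qed.

(** By (X3) it suffices to treat ker E_mu, where 0 works, and the generators F x
    of im F_mu. *)
Lemma min_extends_exists mu :
  (forall b m, (0 < m)%N -> commutes_at (mu + sroot b *+ m)) ->
  exists g : 'Hom(M mu, N mu), forall x, min_extends extension x (g x).
Proof.
move=> comm; have lin c x x' y y' :
    min_extends extension x y -> min_extends extension x' y' ->
    min_extends extension (c *: x + x') (c *: y + y').
  move=> [Fy Ey] [Fy' Ey']; split=> [|a n n0]; first exact/in_imFD/Fy'/in_imFZ.
  by rewrite !linearP /= Ey // Ey' // linearP.
apply: lfun_of_relation => [x||x y y']; [|exact: lin|exact: min_extends_uniq].
have z0 (x' : M mu) : in_kerE x' -> min_extends extension x' 0.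
  by move=> kx; split=> [|a n n0]; [exact: in_imF0 | rewrite kx // !linear0].
have [k [z [kerk imz ->]]] := (X3 M mu).1 x.
suff [z' zz'] : exists z', min_extends extension z z'.
  by exists (1 *: 0 + z'); rewrite -[k]scale1r; apply: lin => //; exact: z0.
move: z imz; apply: in_imF_ind => [|u w [u' uu'] [w' ww']|a n u n0].
- by exists 0; apply: z0 => a n n0; rewrite linear0.
- by exists (1 *: u' + w'); rewrite -[u]scale1r; exact: lin.
- exists (opF N a n (mu + sroot a *+ n) mu (extension _ u)).
  exact: min_extends_opF.
Qed.

Lemma extension_commutes mu :
  commutes_at mu /\
  (mu != la -> forall x, min_extends extension x (extension mu x)).
Proof.
have [d] := ubnP (depth Pi la mu).
elim: d mu => // d IHd mu; rewrite ltnS => le_d.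
have out nu : ~ wle Pi nu la -> commutes_at nu.
  move=> nle; apply: commutes_at_pos => a n n0; split=> x.
    by rewrite (bounded_by_eq0 x bM nle) !linear0.
  exact: bounded_by_eq bN nle.
have comm b m : (0 < m)%N -> commutes_at (mu + sroot b *+ m).
  move=> m0; have [le|/out//] := pselect (wle Pi (mu + sroot b *+ m) la).
  by apply: (IHd _ _).1; rewrite (leq_trans _ le_d) // depth_lt.
have [->|mula] := eqVneq mu la.
  split=> //; apply: commutes_at_pos => a n n0; split=> x.
    exact: bounded_by_eq bN (not_wle_above n0).
  by rewrite (bounded_by_eq0 x bM (not_wle_above n0)) !linear0.
have ext_min x : min_extends extension x (extension mu x).
  rewrite extensionE /extension_step (negPf mula).
  have [g gP] := min_extends_exists comm.
  by case: xgetP => [h _ hP|/(_ g)]; [exact: hP | case].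
split=> //; apply: commutes_at_pos => a n n0; split=> x.
  by have [_ ->] := ext_min x.
exact: min_extends_uniq (ext_min _) (min_extends_opF _ _ _).
Qed.

Lemma min_extension : exists f : Xhom M N,
  f la = phi la /\ forall mu x, mu != la -> in_imF (f mu x).
Proof.
have fE a n mu nu :
    (extension nu \o opE M a n mu nu)%VF = (opE N a n mu nu \o extension mu)%VF.
  by apply/lfunP => x; rewrite !lfunE /=; exact: (extension_commutes mu).1.1.
have fF a n nu mu :
    (extension mu \o opF M a n nu mu)%VF = (opF N a n nu mu \o extension nu)%VF.
  by apply/lfunP => x; rewrite !lfunE /=; exact: (extension_commutes mu).1.2.
exists (XHom fE fF); split=> /= [|mu x mula].
  by rewrite extensionE /extension_step eqxx.
by have [] := (extension_commutes mu).2 mula x.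
Qed.

End Extension.

(** * Splitting idempotents, and uniqueness of S(la) *)

Lemma dim0P (K : fieldType) (U : vectType K) :
  (\dim {: U} = 0%N) <-> (forall x : U, x = 0).
Proof.
split=> [U0 x|U0]; first exact: dim0_eq0.
apply/eqP; rewrite dimv_eq0 -subv0; apply/subvP => x _.
by rewrite (U0 x) mem0v.
Qed.

Section IdempotentImage.
Variables (F : archiRealFieldType) (V : vectType F) (R : rootSystem V).
Variables (Pi : rootBasis R) (K : fieldType) (q : K) (M : Xob Pi q).
Variables (e : Xhom M M).
Hypothesis e_idem : forall mu x, e mu (e mu x) = e mu x.
Implicit Types (mu nu : weight R) (a b : simpleRoot Pi).

(** The image of an idempotent endomorphism inherits all the axioms, since the
    inclusion and the projection commute with the operators. *)
Definition img_space mu : vectType K := subvs_of (limg (e mu)).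

Definition img_incl mu : 'Hom(img_space mu, M mu) := linfun vsval.

Definition img_proj mu : 'Hom(M mu, img_space mu) :=
  (linfun (vsproj (limg (e mu))) \o e mu)%VF.

Lemma img_projK mu x : img_incl mu (img_proj mu x) = e mu x.
Proof. by rewrite !lfunE /= lfunE vsprojK // memv_img ?memvf. Qed.

Lemma img_incl_inj mu : injective (img_incl mu).
Proof. by move=> x y; rewrite !lfunE => /val_inj. Qed.

Lemma e_img_incl mu u : e mu (img_incl mu u) = img_incl mu u.
Proof.
rewrite [img_incl mu u]lfunE /=; have /memv_imgP [x _ ->] := subvsP u.
exact: e_idem.
Qed.

Lemma img_inclK mu u : img_proj mu (img_incl mu u) = u.
Proof. by apply: img_incl_inj; rewrite img_projK e_img_incl. Qed.

Definition img_opE a n mu nu : 'Hom(img_space mu, img_space nu) :=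
  (img_proj nu \o opE M a n mu nu \o img_incl mu)%VF.
Definition img_opF a n nu mu : 'Hom(img_space nu, img_space mu) :=
  (img_proj mu \o opF M a n nu mu \o img_incl nu)%VF.

Fact img_opE_deg a n mu nu : nu != mu + sroot a *+ n -> img_opE a n mu nu = 0.
Proof. by move=> ne; rewrite /img_opE opE_deg // comp_lfun0r comp_lfun0l. Qed.
Fact img_opF_deg a n nu mu : nu != mu + sroot a *+ n -> img_opF a n nu mu = 0.
Proof. by move=> ne; rewrite /img_opF opF_deg // comp_lfun0r comp_lfun0l. Qed.
Fact img_opE0 a mu : img_opE a 0 mu mu = \1%VF.
Proof.
by apply/lfunP => u;
   rewrite /img_opE opE0 comp_lfun1r comp_lfunE img_inclK id_lfunE.
Qed.
Fact img_opF0 a mu : img_opF a 0 mu mu = \1%VF.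
Proof.
by apply/lfunP => u;
   rewrite /img_opF opF0 comp_lfun1r comp_lfunE img_inclK id_lfunE.
Qed.

Definition img_graded : gradedSpace Pi K :=
  GradedSpace img_opE_deg img_opF_deg img_opE0 img_opF0.

Lemma img_incl_opE a n mu nu u :
  img_incl nu (opE img_graded a n mu nu u) = opE M a n mu nu (img_incl mu u).
Proof.
by rewrite /= /img_opE comp_lfunE comp_lfunE img_projK Xhom_opE e_img_incl.
Qed.

Lemma img_incl_opF a n nu mu u :
  img_incl mu (opF img_graded a n nu mu u) = opF M a n nu mu (img_incl nu u).
Proof.
by rewrite /= /img_opF comp_lfunE comp_lfunE img_projK Xhom_opF e_img_incl.
Qed.

Lemma img_proj_opE a n mu nu x :
  img_proj nu (opE M a n mu nu x) = opE img_graded a n mu nu (img_proj mu x).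
Proof. by apply: img_incl_inj; rewrite img_incl_opE !img_projK Xhom_opE. Qed.

Lemma img_proj_opF a n nu mu x :
  img_proj mu (opF M a n nu mu x) = opF img_graded a n nu mu (img_proj nu x).
Proof. by apply: img_incl_inj; rewrite img_incl_opF !img_projK Xhom_opF. Qed.

Fact img_X1 : axiomX1 img_graded.
Proof.
move=> mu; apply: sub_finite_set (X1 M mu) => la [/= nz le]; split=> //=.
apply: contraNN nz => /eqP M0; apply/eqP/dim0P => u.
by apply: img_incl_inj; rewrite linear0; exact: dim0_eq0.
Qed.

Fact img_X2 : axiomX2 q img_graded.
Proof.
move=> mu a b m n m0 n0 x; split=> [ab|ab /=]; apply: (@img_incl_inj).
  rewrite /= !(img_incl_opE, img_incl_opF); exact: opEF_comm.
subst b; rewrite img_incl_opE img_incl_opF (opEF_same _ m0 n0) // linear_sum.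
by apply: eq_bigr => r _; rewrite linearZ /= img_incl_opF img_incl_opE.
Qed.

Lemma img_proj_kerE mu x : in_kerE x -> in_kerE (M := img_graded) (img_proj mu x).
Proof. by move=> kx a n n0; rewrite -img_proj_opE kx // linear0. Qed.

Fact img_X3 : axiomX3 img_graded.
Proof.
move=> mu; split=> [u|u ku imu].
  have [y [z [ky iz e_u]]] := (X3 M mu).1 (img_incl mu u).
  exists (img_proj mu y), (img_proj mu z); split.
  - exact: img_proj_kerE.
  - move: z iz {e_u}; apply: in_imF_ind => [|z z'|a n z n0].
    + by rewrite linear0; exact: in_imF0.
    + by rewrite linearD; exact: in_imFD.
    + by rewrite img_proj_opF; exact: in_imF_opF.
  - rewrite -(linearD (img_proj mu)) -e_u. exact: (esym (img_inclK u)).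
apply: img_incl_inj; rewrite linear0; apply: (X3 M mu).2.
  by move=> a n n0; rewrite -img_incl_opE ku // linear0.
move: u imu {ku}; apply: in_imF_ind => [|z z'|a n z n0].
- by rewrite linear0; exact: in_imF0.
- by rewrite linearD; exact: in_imFD.
- by rewrite img_incl_opF; exact: in_imF_opF.
Qed.

Definition img_ob : Xob Pi q := XOb img_X1 img_X2 img_X3.

Fact img_incl_homE a n mu nu :
  (img_incl nu \o opE img_ob a n mu nu)%VF = (opE M a n mu nu \o img_incl mu)%VF.
Proof.
by apply/lfunP => u;
   rewrite [LHS]comp_lfunE [RHS]comp_lfunE; exact: img_incl_opE.
Qed.

Fact img_incl_homF a n nu mu :
  (img_incl mu \o opF img_ob a n nu mu)%VF = (opF M a n nu mu \o img_incl nu)%VF.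
Proof.
by apply/lfunP => u;
   rewrite [LHS]comp_lfunE [RHS]comp_lfunE; exact: img_incl_opF.
Qed.

Fact img_proj_homE a n mu nu :
  (img_proj nu \o opE M a n mu nu)%VF = (opE img_ob a n mu nu \o img_proj mu)%VF.
Proof.
by apply/lfunP => x;
   rewrite [LHS]comp_lfunE [RHS]comp_lfunE; exact: img_proj_opE.
Qed.

Fact img_proj_homF a n nu mu :
  (img_proj mu \o opF M a n nu mu)%VF = (opF img_ob a n nu mu \o img_proj nu)%VF.
Proof.
by apply/lfunP => x;
   rewrite [LHS]comp_lfunE [RHS]comp_lfunE; exact: img_proj_opF.
Qed.

Definition img_inclX : Xhom img_ob M :=
  @XHom _ _ _ _ _ _ img_ob M img_incl img_incl_homE img_incl_homF.
Definition img_projX : Xhom M img_ob :=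
  @XHom _ _ _ _ _ _ M img_ob img_proj img_proj_homE img_proj_homF.

Lemma img_ob_is_zero mu (x : M mu) : is_zero img_ob -> e mu x = 0.
Proof.
by move=> z; rewrite -img_projK (dim0_eq0 (img_proj mu x) (z mu)) linear0.
Qed.

End IdempotentImage.

Section Splitting.
Variables (F : archiRealFieldType) (V : vectType F) (R : rootSystem V).
Variables (Pi : rootBasis R) (K : fieldType) (q : K).
Implicit Types (mu nu la : weight R) (a b : simpleRoot Pi).

Section Complement.
Variables (M : Xob Pi q) (e : Xhom M M).

Definition compl_map mu : 'Hom(M mu, M mu) := \1%VF - e mu.

Lemma compl_mapE mu x : compl_map mu x = x - e mu x.
Proof. by rewrite add_lfunE opp_lfunE id_lfunE. Qed.

Fact compl_homE a n mu nu :
  (compl_map nu \o opE M a n mu nu)%VF = (opE M a n mu nu \o compl_map mu)%VF.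
Proof.
apply/lfunP => x; rewrite [LHS]comp_lfunE [RHS]comp_lfunE !compl_mapE.
by rewrite linearB /= Xhom_opE.
Qed.

Fact compl_homF a n nu mu :
  (compl_map mu \o opF M a n nu mu)%VF = (opF M a n nu mu \o compl_map nu)%VF.
Proof.
apply/lfunP => x; rewrite [LHS]comp_lfunE [RHS]comp_lfunE !compl_mapE.
by rewrite linearB /= Xhom_opF.
Qed.

Definition complX : Xhom M M :=
  @XHom _ _ _ _ _ _ M M compl_map compl_homE compl_homF.

Lemma complXE mu x : complX mu x = x - e mu x.
Proof. exact: compl_mapE. Qed.

End Complement.

Lemma indecomposable_idempotent (M : Xob Pi q) (e : Xhom M M) :
  (forall mu x, e mu (e mu x) = e mu x) -> indecomposable M ->
  (forall mu x, e mu x = 0) \/ (forall mu x, e mu x = x).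
Proof.
move=> ee [_ indM]; set f := complX e.
have ff mu x : f mu (f mu x) = f mu x.
  by rewrite !complXE linearB /= ee subrr subr0.
have ef mu x : e mu (f mu x) = 0 by rewrite complXE linearB /= ee subrr.
have fe mu x : f mu (e mu x) = 0 by rewrite complXE ee subrr.
have : is_direct_sum M (img_ob ee) (img_ob ff).
  exists (img_inclX ee), (img_inclX ff), (img_projX ee), (img_projX ff) => mu.
  split; apply/lfunP => x.
  - rewrite [LHS]comp_lfunE id_lfunE; exact: img_inclK.
  - rewrite [LHS]comp_lfunE id_lfunE; exact: img_inclK.
  - rewrite [LHS]comp_lfunE zero_lfunE; apply: (@img_incl_inj _ _ _ _ _ _ _ e).
    by rewrite linear0 img_projK -[X in e mu X](e_img_incl ff) ef.
  - rewrite [LHS]comp_lfunE zero_lfunE; apply: (@img_incl_inj _ _ _ _ _ _ _ f).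
    by rewrite linear0 img_projK -[X in f mu X](e_img_incl ee) fe.
  - rewrite add_lfunE [X in X + _]comp_lfunE [X in _ + X]comp_lfunE id_lfunE.
    by rewrite !img_projK complXE subrKC.
case/indM=> z; [left | right] => mu x; first exact: img_ob_is_zero x z.
by apply/eqP; rewrite eq_sym -subr_eq0 -complXE; rewrite (img_ob_is_zero x z).
Qed.

(** What becomes of [is_S] when indecomposability is expressed without reference
    to other objects. *)
Definition generated_below la (M : Xob Pi q) : Prop :=
  [/\ \dim {: M la} = 1%N, bounded_by la M
    & forall mu (x : M mu), mu != la -> in_imF x].

(** Extend the identity of M_la to e with image in im F_mu away from la. As e e
    extends the same map in the same way, e is idempotent, hence the identity. *)
Lemma is_S_generated la (M : Xob Pi q) : is_S la M -> generated_below la M.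
Proof.
move=> [indM dimM bM]; split=> //.
have [e [ela eF]] := min_extension bM bM (fun mu => \1%VF).
have ee : Xcomp e e = e.
  apply: (Xhom_uniq bM) => //=; first by rewrite ela comp_lfun1l.
  by move=> mu x mula; rewrite comp_lfunE; exact: eF.
have ee' mu x : e mu (e mu x) = e mu x by rewrite -comp_lfunE -[in RHS]ee.
have [e0|e1] := indecomposable_idempotent ee' indM; last first.
  by move=> mu x mula; rewrite -(e1 mu x); exact: eF.
suff : \dim {: M la} = 0%N by rewrite dimM.
by apply/dim0P => x; rewrite -(id_lfunE x) -ela e0.
Qed.

Lemma dim1_generator (U : vectType K) : \dim {: U} = 1%N ->
  exists (u : U) (c : {scalar U}), (forall x, x = c x *: u) /\ c u = 1.
Proof.
move=> dimU; move: (vbasis {: U}) (vbasisP {: U}); rewrite dimU => X basisX.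
exists X`_0, (coord X 0); split=> [x|].
  by rewrite {1}(coord_basis basisX (memvf x)) big_ord1.
exact: (coord_free (0 : 'I_1) 0 (basis_free basisX)).
Qed.

Lemma dim1_iso (U W : vectType K) : \dim {: U} = 1%N -> \dim {: W} = 1%N ->
  exists (f : 'Hom(U, W)) (g : 'Hom(W, U)),
    (g \o f = \1)%VF /\ (f \o g = \1)%VF.
Proof.
move=> /dim1_generator [u [c [cE cu]]] /dim1_generator [w [d [dE dw]]].
have scale_map (U1 W1 : vectType K) (c1 : {scalar U1}) (w1 : W1) :
    exists f : 'Hom(U1, W1), forall x, f x = c1 x *: w1.
  apply: (@lfun_of_relation _ U1 W1 (fun x y => y = c1 x *: w1)).
  - by move=> x; eexists.
  - by move=> k x x' _ _ -> ->; rewrite linearP scalerDl scalerA.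
  - by move=> x y y' -> ->.
have [f fE] := scale_map _ _ c w; have [g gE] := scale_map _ _ d u.
exists f, g; split; apply/lfunP => x; rewrite comp_lfunE id_lfunE.
  by rewrite fE gE linearZ /= dw mulr1 -cE.
by rewrite gE fE linearZ /= cu mulr1 -dE.
Qed.

(** Extend inverse isomorphisms between the highest weight lines; both
    composites agree with the identity at la, and uniqueness of extensions
    applies because all of M_mu and N_mu is in the image of F. *)
Lemma generated_below_iso la (M N : catX Pi q) :
  generated_below la M -> generated_below la N -> isomorphic M N.
Proof.
move=> [dimM bM gM] [dimN bN gN]; have [f0 [g0 [gf fg]]] := dim1_iso dimM dimN.
(* The extension principle takes a family of maps over all weights, of which only
   the member at la counts; choosing an inverse pair wherever there is one avoids
   a case distinction on mu = la in the types. *)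
pose phi mu : 'Hom(M mu, N mu) :=
  xget 0 [set f | exists g, (g \o f = \1)%VF /\ (f \o g = \1)%VF]%classic.
have [g1 [gphi phig]] :
    exists g, (g \o phi la = \1)%VF /\ (phi la \o g = \1)%VF.
  rewrite /phi; case: xgetP => [//|/(_ f0)]; case; by exists g0.
pose psi mu : 'Hom(N mu, M mu) :=
  xget 0 [set g | (g \o phi mu = \1)%VF /\ (phi mu \o g = \1)%VF]%classic.
have [psiphi phipsi] :
    (psi la \o phi la = \1)%VF /\ (phi la \o psi la = \1)%VF.
  by rewrite /psi; case: xgetP => [//|/(_ g1)]; case; split.
have [f [fla _]] := min_extension bM bN phi.
have [g [gla _]] := min_extension bN bM psi.
exists f, g; split.
  apply: (Xhom_uniq bM); rewrite /= ?fla ?gla ?psiphi // => mu x; exact: gM.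
apply: (Xhom_uniq bN); rewrite /= ?fla ?gla ?phipsi // => mu x; exact: gN.
Qed.

End Splitting.

(** * Signs *)

Section Twist.
Variables (F : archiRealFieldType) (V : vectType F) (R : rootSystem V).
Variables (Pi : rootBasis R) (K : fieldType) (eps : K).
Hypothesis eps_sqr : eps * eps = 1.
Hypothesis cartan_sym :
  forall a b : simpleRoot Pi, a != b -> pairing (sroot a) b = pairing (sroot b) a.
Implicit Types (mu nu : weight R) (a b c : simpleRoot Pi).

(** A function of mu that is additive along the simple roots, with b |-> <b,
    a^vee> for b after a in the enumeration and 0 otherwise. It need not extend
    linearly to integral values on all weights, and the floor of the coordinates
    is a way to choose it on every coset of the root lattice. *)
Definition twist_form a mu : int :=
  \sum_(b : simpleRoot Pi | (enum_rank a < enum_rank b)%N)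
    pairing (sroot b) a * Num.floor (simpleCoord b (wval mu)).

Lemma twist_formD a mu c n : twist_form a (mu + sroot c *+ n) =
  twist_form a mu +
  (if (enum_rank a < enum_rank c)%N then pairing (sroot c) a * n%:Z else 0).
Proof.
have E b : Num.floor (simpleCoord b (wval (mu + sroot c *+ n))) =
    Num.floor (simpleCoord b (wval mu)) + (if b == c then n%:Z else 0).
  rewrite wvalD wvalMn simpleCoordD simpleCoordMn simpleCoordE eq_sym.
  case: eqP => _; last by rewrite mul0rn !addr0.
  rewrite -[n%:R]/((n%:Z)%:~R) floorDrz ?intr_int //.
  by congr (_ + _); rewrite intrKfloor.
rewrite /twist_form.
under eq_bigr => b _ do rewrite E mulrDr.
rewrite big_split /=; congr (_ + _).
rewrite big_mkcond (bigD1 c) //= eqxx big1 ?addr0 //.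
by move=> b /negPf ->; rewrite mulr0 if_same.
Qed.

(** The quadratic parts C(n, 2) of the two exponents account for the terms r m
    and r n in the sign r (<mu, a^vee> + m + n - r) of the Lucas theorem. *)
Definition twistE a n mu : int := twist_form a mu * n%:Z + 'C(n, 2)%:Z + n%:Z.
Definition twistF a n mu : int :=
  (twist_form a mu + pairing mu a) * n%:Z + 'C(n, 2)%:Z.

(** The exponents change by m times the linear part for E_a at n b and by n
    times the one for F_b at m a. If a comes before b, these are m n <b, a^vee>
    and m n <a, b^vee>; otherwise they are 0 and 2 m n <a, b^vee>. The sum is
    even. *)
Lemma twist_comm a b m n mu : a != b ->
  eps ^ twistE a m mu * eps ^ twistF b n mu =
  eps ^ twistE a m (mu + sroot b *+ n) * eps ^ twistF b n (mu + sroot a *+ m).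
Proof.
move=> ab; rewrite -!expfzDr ?sqr1_neq0 //; apply: (expz_mod2 eps_sqr).
rewrite /twistE /twistF !twist_formD pairingD pairingMn.
rewrite (cartan_sym ab).
have := ab; rewrite -(inj_eq enum_rank_inj) -val_eqE neq_ltn /=.
case: ltngtP => // _ _; exists (- (pairing (sroot b) a * m%:Z * n%:Z)); ring.
Qed.

Lemma bin2D (m n : nat) : 'C(m + n, 2) = ('C(m, 2) + 'C(n, 2) + m * n)%N.
Proof.
elim: m => [|m IHm]; first by rewrite bin0n mul0n addn0.
by rewrite addSn !binS !bin1 IHm; lia.
Qed.

(** Modulo 2 the linear parts for E_a and F_a add up to <mu, a^vee> and are
    constant along a; the rest is r r = 2 C(r, 2) + r. *)
Lemma twist_same a m n r mu : (r <= m)%N -> (r <= n)%N ->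
  eps ^ twistE a m mu * eps ^ twistF a n mu =
  eps ^ (r%:Z * (pairing mu a + m%:Z + n%:Z - r%:Z))
    * (eps ^ twistE a (m - r) (mu + sroot a *+ n)
       * eps ^ twistF a (n - r) (mu + sroot a *+ m)).
Proof.
rewrite -!expfzDr ?sqr1_neq0 // => /subnK <- /subnK <-.
rewrite !addnK; move: (m - r)%N (n - r)%N => {}m {}n.
apply: (expz_mod2 eps_sqr); rewrite /twistE /twistF !twist_formD ltnn !addr0.
rewrite pairingD pairingMn.
rewrite pairing_self !bin2D !PoszD !PoszM.
have rr : r%:Z * r%:Z = 'C(r, 2)%:Z * 2 + r%:Z.
  by elim: r => [|r IHr]; [rewrite bin0n | rewrite binS bin1; lia].
(* Here m and n stand for the former m - r and n - r. *)
exists (twist_form a mu * r%:Z - (m%:Z + r%:Z) * n%:Z).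
move: rr; move: (twist_form _ _) (pairing _ _) ('C(r, 2)%:Z) => t p c.
move: (r%:Z) (m%:Z) (n%:Z) ('C(m, 2)%:Z) ('C(n, 2)%:Z) => {}r {}m {}n x y.
by lia.
Qed.

End Twist.

(** * The Frobenius functor *)

Section DivideWeight.
Variables (F : archiRealFieldType) (V : vectType F) (R : rootSystem V) (l : nat).
Hypothesis l_gt0 : (0 < l)%N.
Implicit Types (mu nu : weight R).

(** Division by l on weights: l is invertible in F, so one divides in V and
    tests whether the result is a weight. *)
Definition divw nu : option (weight R) := insub (l%:R^-1 *: wval nu).

Lemma divwMn mu : divw (mu *+ l) = Some mu.
Proof.
rewrite /divw wvalMn -scaler_nat scalerA mulVf ?pnatr_eq0 -?lt0n // scale1r.
exact: (valK mu).
Qed.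

Lemma divw_some nu mu : divw nu = Some mu -> nu = mu *+ l.
Proof.
rewrite /divw; case: insubP => //= u _ e [<-]; apply: val_inj => /=.
by rewrite wvalMn e -scaler_nat scalerA mulfV ?pnatr_eq0 -?lt0n // scale1r.
Qed.

Lemma divw_addMn mu mu0 (al : weight R) n : divw mu = Some mu0 ->
  divw (mu + al *+ (n * l)) = Some (mu0 + al *+ n).
Proof. by move=> /divw_some ->; rewrite mulrnA -mulrnDl divwMn. Qed.

Lemma divw_subMn mu nu0 (al : weight R) n :
  divw (mu + al *+ (n * l)) = Some nu0 ->
  divw mu = Some (nu0 - al *+ n).
Proof.
move=> /divw_some nuE; rewrite -divwMn mulrnBl -nuE mulrnA addrK //.
Qed.

End DivideWeight.

Lemma sum_multiples (W : nmodType) (l k : nat) (G : nat -> W) : (0 < l)%N ->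
  (forall r, (r <= k * l)%N -> ~~ (l %| r)%N -> G r = 0) ->
  \sum_(0 <= r < (k * l).+1) G r = \sum_(0 <= r < k.+1) G (r * l)%N.
Proof.
move=> l0; elim: k => [|k IHk] G0; first by rewrite mul0n !big_nat1.
have kl : (k * l < k * l + l)%N by rewrite -[X in (X < _)%N]addn0 ltn_add2l.
rewrite [RHS]big_nat_recr //= -IHk; last first.
  by move=> r rk; apply: G0; rewrite (leq_trans rk) // mulSn leq_addl.
rewrite mulSn addnC.
rewrite (@big_cat_nat _ _ _ (k * l).+1) //=; last by rewrite ltnS leq_addr.
congr (_ + _); rewrite big_nat_recr //= big_nat_cond big1 ?add0r //.
move=> i; rewrite andbT => /andP[lo hi].
apply: G0; first by rewrite mulSn addnC ltnW.
apply/negP => /dvdnP [j e]; move: lo hi; rewrite e.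
rewrite ltn_pmul2r // => kj; rewrite ltnNge; apply/negP/negPn.
have : (k.+1 * l <= j * l)%N by rewrite leq_mul2r kj orbT.
by rewrite mulSn; lia.
Qed.

Fact lfunZ (K : fieldType) (U W : vectType K) (f : 'Hom(U, W)) c x :
  f (c *: x) = c *: f x.
Proof. exact: linearZ. Qed.

(** What enters about q are the values of (l k choose r), with a sign eps that
    relates them to binomial coefficients. *)
Section Frobenius.
Variables (F : archiRealFieldType) (V : vectType F) (R : rootSystem V).
Variables (Pi : rootBasis R) (K : fieldType) (q : K) (l : nat) (eps : K).
Hypothesis l_gt0 : (0 < l)%N.
Hypothesis eps_sqr : eps * eps = 1.
Hypothesis cartan_sym :
  forall a b : simpleRoot Pi, a != b -> pairing (sroot a) b = pairing (sroot b) a.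
Hypothesis gbin_mult : forall (k : int) (b : nat),
  gbin q (l%:Z * k) (l%:Z * b%:Z) = eps ^ (b%:Z * (k - b%:Z)) * gbin 1 k b%:Z.
Hypothesis gbin_nmult : forall (k : int) (r : nat),
  ~~ (l %| r)%N -> gbin q (l%:Z * k) r%:Z = 0.
Implicit Types (mu nu : weight R) (a b c : simpleRoot Pi) (o : option (weight R)).

Local Notation twistE := (twistE (Pi := Pi)).
Local Notation twistF := (twistF (Pi := Pi)).

Section Object.
Variable M : gradedSpace Pi K.

(** Weights outside l X get the zero space. The operators are first defined on
    optional weights: an equation [divw l nu = Some mu] can then be rewritten in
    the types of all the spaces and maps at once. *)
Definition opt_space o : vectType K := if o is Some mu then M mu else 'rV[K]_0.

Lemma opt_space_none (x : opt_space None) : x = 0.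
Proof. exact: thinmx0. Qed.

Definition opt_opE a n o o' : 'Hom(opt_space o, opt_space o') :=
  match o, o' with
  | Some mu, Some nu =>
      if (l %| n)%N then eps ^ twistE a (n %/ l) mu *: opE M a (n %/ l) mu nu
      else 0
  | _, _ => 0
  end.

Definition opt_opF a n o' o : 'Hom(opt_space o', opt_space o) :=
  match o', o with
  | Some nu, Some mu =>
      if (l %| n)%N then eps ^ twistF a (n %/ l) mu *: opF M a (n %/ l) nu mu
      else 0
  | _, _ => 0
  end.

Lemma opt_opE_ndvd a n o o' : ~~ (l %| n)%N -> opt_opE a n o o' = 0.
Proof.
by move=> /negPf ln; rewrite /opt_opE; case: o o' => [mu|] [nu|] //; rewrite ln.
Qed.

Lemma opt_opF_ndvd a n o' o : ~~ (l %| n)%N -> opt_opF a n o' o = 0.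
Proof.
by move=> /negPf ln; rewrite /opt_opF; case: o' o => [mu|] [nu|] //; rewrite ln.
Qed.

Lemma opt_opE_mul a n mu nu x : opt_opE a (n * l) (Some mu) (Some nu) x =
  eps ^ twistE a n mu *: opE M a n mu nu x.
Proof. by rewrite /= dvdn_mull // mulnK // scale_lfunE. Qed.

Lemma opt_opF_mul a n nu mu x : opt_opF a (n * l) (Some nu) (Some mu) x =
  eps ^ twistF a n mu *: opF M a n nu mu x.
Proof. by rewrite /= dvdn_mull // mulnK // scale_lfunE. Qed.

Definition frob_space nu : vectType K := opt_space (divw l nu).
Definition frob_opE a n mu nu : 'Hom(frob_space mu, frob_space nu) :=
  opt_opE a n (divw l mu) (divw l nu).
Definition frob_opF a n nu mu : 'Hom(frob_space nu, frob_space mu) :=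
  opt_opF a n (divw l nu) (divw l mu).

Fact frob_opE_deg a n mu nu : nu != mu + sroot a *+ n -> frob_opE a n mu nu = 0.
Proof.
rewrite /frob_opE /frob_space; case emu : (divw l mu) => [mu0|] //.
case enu : (divw l nu) => [nu0|] //=; case: ifP => // /dvdnP [k ->].
rewrite (divw_some l_gt0 emu) (divw_some l_gt0 enu) mulnK // mulrnA -mulrnDl.
by move=> ne; rewrite opE_deg ?scaler0 //; apply: contraNneq ne => ->.
Qed.

Fact frob_opF_deg a n nu mu : nu != mu + sroot a *+ n -> frob_opF a n nu mu = 0.
Proof.
rewrite /frob_opF /frob_space; case enu : (divw l nu) => [nu0|] //.
case emu : (divw l mu) => [mu0|] //=; case: ifP => // /dvdnP [k ->].
rewrite (divw_some l_gt0 emu) (divw_some l_gt0 enu) mulnK // mulrnA -mulrnDl.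
by move=> ne; rewrite opF_deg ?scaler0 //; apply: contraNneq ne => ->.
Qed.

Fact frob_opE0 a mu : frob_opE a 0 mu mu = \1%VF.
Proof.
rewrite /frob_opE /frob_space; case: (divw l mu) => [mu0|] /=.
  by rewrite dvdn0 div0n /twistE mulr0 expr0z scale1r opE0.
by apply/lfunP => x; rewrite (opt_space_none x) !linear0.
Qed.

Fact frob_opF0 a mu : frob_opF a 0 mu mu = \1%VF.
Proof.
rewrite /frob_opF /frob_space; case: (divw l mu) => [mu0|] /=.
  by rewrite dvdn0 div0n /twistF mulr0 expr0z scale1r opF0.
by apply/lfunP => x; rewrite (opt_space_none x) !linear0.
Qed.

Definition frob_graded : gradedSpace Pi K :=
  GradedSpace frob_opE_deg frob_opF_deg frob_opE0 frob_opF0.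

Lemma frob_support nu : \dim {: frob_space nu} != 0%N ->
  exists2 mu, nu = mu *+ l & \dim {: M mu} != 0%N.
Proof.
rewrite /frob_space; case e : (divw l nu) => [mu|] /=.
  by exists mu => //; exact: divw_some.
by case/eqP; apply/dim0P => x; exact: opt_space_none.
Qed.

End Object.

Section ObjectX.
Variable M : Xob Pi (1 : K).

(** If mu <= l la, reduce the coefficients of l la - mu modulo l: with
    remainders e_a, the weight mu + sum_a e_a a is l w for some w <= la. There
    are finitely many choices of e, and for each of them finitely many la above
    w. *)
Fact frob_X1 : axiomX1 (frob_graded M).
Proof.
move=> mu; pose shift (e : {ffun simpleRoot Pi -> 'I_l}) :=
  divw l (mu + \sum_a sroot a *+ e a).
pose above o : set (weight R) := if o is Some w then
  [set la | gsupport M la /\ wle Pi w la]%classic else set0.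
apply: (@sub_finite_set _ _
  (\bigcup_(e in [set: {ffun simpleRoot Pi -> 'I_l}])
     ((fun la => la *+ l) @` above (shift e)))%classic); last first.
  apply: bigcup_finite => [|e _]; first exact: finite_finset.
  apply: finite_image; rewrite /above.
  case: (shift e) => [w|]; last exact: finite_set0.
  exact: (X1 M w).
move=> nu [/frob_support [la -> laM] [c ce]].
exists [ffun a => Ordinal (ltn_pmod (c a) l_gt0)] => //.
exists la => //; rewrite /above /shift.
pose w := la - \sum_a sroot a *+ (c a %/ l).
have -> : mu + \sum_a sroot a *+ [ffun a => Ordinal (ltn_pmod (c a) l_gt0)] a =
    w *+ l.
  rewrite /w mulrnBl -sumrMnl.
  have -> : mu = la *+ l - \sum_a sroot a *+ c a by rewrite -ce subKr.
  rewrite -addrA; congr (_ + _); apply/eqP.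
  rewrite addrC subr_eq addrC -subr_eq opprK.
  rewrite -big_split /=; apply/eqP/eq_bigr => a _.
  by rewrite ffunE /= -mulrnA -mulrnDr addnC -divn_eq.
rewrite divwMn //; split=> //; exists (fun a => (c a %/ l)%N).
by rewrite /w subKr.
Qed.

Lemma frob_rule_comm mu a b m n (x : frob_space M (mu + sroot b *+ n)) :
  a != b -> (0 < m)%N -> (0 < n)%N ->
  frob_opE M a m mu (mu + sroot a *+ m)
    (frob_opF M b n (mu + sroot b *+ n) mu x) =
  frob_opF M b n (mu + sroot b *+ n + sroot a *+ m) (mu + sroot a *+ m)
    (frob_opE M a m (mu + sroot b *+ n) (mu + sroot b *+ n + sroot a *+ m) x).
Proof.
move=> ab m0 n0; rewrite /frob_opE /frob_opF.
have [/dvdnP [m' mE]|lm] := boolP (l %| m)%N; last first.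
  by rewrite !(opt_opE_ndvd _ _ _ _ lm) !zero_lfunE linear0.
have [/dvdnP [n' nE]|ln] := boolP (l %| n)%N; last first.
  by rewrite !(opt_opF_ndvd _ _ _ _ ln) !zero_lfunE linear0.
subst m n; move: x; rewrite /frob_space.
case enu : (divw l (mu + sroot b *+ (n' * l))) => [nu0|] x; last first.
  by rewrite (opt_space_none x) !linear0.
have m'0 : (0 < m')%N by case: m' m0 {ab}.
have n'0 : (0 < n')%N by case: n' n0 {enu}.
have dmu := divw_subMn l_gt0 enu; have nu0E := esym (subrK (sroot b *+ n') nu0).
rewrite dmu (divw_addMn l_gt0 _ _ enu) (divw_addMn l_gt0 _ _ dmu).
rewrite opt_opF_mul lfunZ !opt_opE_mul lfunZ opt_opF_mul !scalerA.
rewrite (opEF_comm _ ab m'0 n'0 nu0E erefl erefl).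
rewrite [eps ^ twistF _ _ _ * _]mulrC.
by rewrite (twist_comm eps_sqr cartan_sym _ _ _ ab) subrK.
Qed.

(** If l divides m and n, only the terms with l | r survive, and the
    coefficients match by the Lucas theorem. Otherwise the left side is 0; on
    the right, a nonzero term needs m = n = r modulo l with r not divisible by
    l, and then <mu, a^vee> + m + n is a multiple of l, so that the binomial
    vanishes. *)
Lemma frob_rule_same mu a m n (x : frob_space M (mu + sroot a *+ n)) :
  (0 < m)%N -> (0 < n)%N ->
  frob_opE M a m mu (mu + sroot a *+ m)
    (frob_opF M a n (mu + sroot a *+ n) mu x) =
  \sum_(0 <= r < (minn m n).+1)
    gbin q (pairing mu a + m%:Z + n%:Z) r%:Z *:
    frob_opF M a (n - r) (mu + sroot a *+ n + sroot a *+ (m - r))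
      (mu + sroot a *+ m)
      (frob_opE M a (m - r) (mu + sroot a *+ n)
         (mu + sroot a *+ n + sroot a *+ (m - r)) x).
Proof.
move=> m0 n0; rewrite /frob_opE /frob_opF; move: x; rewrite /frob_space.
case enu : (divw l (mu + sroot a *+ n)) => [nu0|] x; last first.
  by rewrite (opt_space_none x) !linear0 big1 // => r _; rewrite !linear0.
have [/andP[/dvdnP [m' mE] /dvdnP [n' nE]]|ndvd] :=
  boolP ((l %| m)%N && (l %| n)%N).
  subst m n; have m'0 : (0 < m')%N by case: m' m0.
  have n'0 : (0 < n')%N by case: n' n0 {x enu}.
  have dmu := divw_subMn l_gt0 enu; have nu0E := esym (subrK (sroot a *+ n') nu0).
  have nuE := divw_some l_gt0 enu; have muE := divw_some l_gt0 dmu.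
  rewrite -minnMl sum_multiples //; last first.
    move=> r; rewrite minnMl leq_min => /andP[rm rn] lr.
    rewrite opt_opE_ndvd ?zero_lfunE ?linear0 ?scaler0 //.
    by apply: contra lr => h; rewrite -(dvdn_addr _ h) subnK // dvdn_mull.
  rewrite dmu (divw_addMn l_gt0 _ _ dmu) opt_opF_mul lfunZ opt_opE_mul scalerA.
  rewrite (opEF_same _ m'0 n'0 nu0E erefl) scaler_sumr; apply: eq_big_nat => r.
  rewrite ltnS leq_min => /andP[_ /andP[rm rn]].
  rewrite -!mulnBl (divw_addMn l_gt0 _ _ enu).
  rewrite opt_opE_mul lfunZ opt_opF_mul !scalerA.
  congr (_ *: _); rewrite {1}muE pairingMn.
  set mu0 := nu0 - _ in nu0E *.
  have -> : pairing mu0 a * l%:Z + (m' * l)%N%:Z + (n' * l)%N%:Z =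
    l%:Z * (pairing mu0 a + m'%:Z + n'%:Z) by rewrite !PoszM; ring.
  rewrite [(r * l)%N]mulnC PoszM gbin_mult.
  rewrite [eps ^ twistF _ _ _ * _]mulrC (twist_same eps_sqr a mu0 rm rn) -nu0E.
  move: (eps ^ twistE _ _ _) (eps ^ twistF _ _ _) => cE cF.
  by move: (eps ^ _) (gbin 1 _ _) => c g; ring.
have -> : opt_opE M a m (divw l mu) (divw l (mu + sroot a *+ m))
    (opt_opF M a n (Some nu0) (divw l mu) x) = 0.
  move: ndvd; rewrite negb_and => /orP [lm|ln].
    by rewrite opt_opE_ndvd // zero_lfunE.
  by rewrite opt_opF_ndvd // zero_lfunE linear0.
rewrite big_nat_cond big1 // => r; rewrite andbT ltnS leq_min => /and3P[_ rm rn].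
have [/dvdnP [u uE]|lm] := boolP (l %| m - r)%N; last first.
  by rewrite (opt_opE_ndvd _ _ _ _ lm) zero_lfunE linear0 scaler0.
have [/dvdnP [w wE]|ln] := boolP (l %| n - r)%N; last first.
  by rewrite (opt_opF_ndvd _ _ _ _ ln) zero_lfunE scaler0.
have nuE := divw_some l_gt0 enu.
have -> : pairing mu a + m%:Z + n%:Z = l%:Z * (pairing nu0 a + u%:Z - w%:Z).
  have := congr1 (fun la => pairing la a) nuE.
  rewrite /= pairingD !pairingMn pairing_self => e.
  have : m%:Z = u%:Z * l%:Z + r%:Z by rewrite -PoszM -uE -PoszD subnK.
  have : n%:Z = w%:Z * l%:Z + r%:Z by rewrite -PoszM -wE -PoszD subnK.
  by move=> en em; rewrite -(addrK (2 * n%:Z) (pairing mu a)) e em en; ring.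
rewrite gbin_nmult ?scale0r //; apply: contra ndvd => lr.
by rewrite -(subnK rm) -(subnK rn) uE wE !dvdn_add ?dvdn_mull.
Qed.

Fact frob_X2 : axiomX2 q (frob_graded M).
Proof.
move=> mu a b m n m0 n0 x; split=> [ab|ab]; first exact: frob_rule_comm.
by subst b; exact: frob_rule_same.
Qed.

Definition opt_kerE o : opt_space M o -> Prop :=
  if o is Some mu then fun x : M mu => in_kerE x else fun _ => True.

Definition opt_imF o : opt_space M o -> Prop :=
  if o is Some mu then fun x : M mu => in_imF x else fun _ => True.

Lemma frob_kerE nu (x : frob_graded M nu) : in_kerE x <-> opt_kerE x.
Proof.
rewrite /in_kerE /= /frob_opE; move: x; rewrite /= /frob_space.
case enu : (divw l nu) => [mu|] x; last first.
  by split=> // _ a n _; rewrite (opt_space_none x) linear0.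
split=> kx a n n0.
  have := kx a (n * l)%N; rewrite muln_gt0 n0 l_gt0 (divw_addMn l_gt0 _ _ enu).
  move=> /(_ isT) /eqP; rewrite opt_opE_mul scaler_eq0 expfz_eq0.
  by rewrite (negPf (sqr1_neq0 eps_sqr)) andbF => /eqP.
have [/dvdnP [m nE]|ln] := boolP (l %| n)%N; last first.
  by rewrite opt_opE_ndvd // zero_lfunE.
subst n; rewrite (divw_addMn l_gt0 _ _ enu) opt_opE_mul kx ?scaler0 //.
by case: m n0.
Qed.

Lemma opt_imF_opF a n o' o y : (0 < n)%N -> opt_imF (opt_opF M a n o' o y).
Proof.
case: o' y => [nu|] y; case: o => [mu|] //= n0; last first.
  by rewrite zero_lfunE; exact: in_imF0.
case: ifP => [ln|_]; last by rewrite zero_lfunE; exact: in_imF0.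
by rewrite scale_lfunE; apply/in_imFZ/in_imF_opF; rewrite divn_gt0 // dvdn_leq.
Qed.

(** im F_mu of M is contained in im F_(l mu) of the new object, in the form of
    an induction principle, which avoids comparing the two types of vectors. *)
Lemma opt_imF_ind nu (P : opt_space M (divw l nu) -> Prop) :
  P 0 -> (forall x y, P x -> P y -> P (x + y)) ->
  (forall (k : K) x, P x -> P (k *: x)) ->
  (forall a n (y : opt_space M (divw l (nu + sroot a *+ n))), (0 < n)%N ->
     P (opt_opF M a n (divw l (nu + sroot a *+ n)) (divw l nu) y)) ->
  forall x, opt_imF x -> P x.
Proof.
move: P; case enu : (divw l nu) => [mu|] P P0 PD PZ PF x; last first.
  by rewrite (opt_space_none x).
move: x; apply: in_imF_ind => // a n y n0.
move: (PF a (n * l)%N); rewrite (divw_addMn l_gt0 _ _ enu) => /(_ y).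
rewrite muln_gt0 n0 l_gt0 => /(_ isT) /(PZ (eps ^ twistF a n mu)^-1).
by rewrite opt_opF_mul scalerA mulVf ?scale1r // expfz_neq0 ?sqr1_neq0.
Qed.

Lemma frob_imF nu (x : frob_graded M nu) : in_imF x <-> opt_imF x.
Proof.
split.
  move: x; apply: in_imF_ind => [|x y|a n y n0]; last exact: opt_imF_opF.
    by rewrite /= /frob_space; case: (divw l nu) => [mu|] //=; exact: in_imF0.
  move: x y; rewrite /= /frob_space.
  case: (divw l nu) => [mu|] //= x y; exact: in_imFD.
apply: opt_imF_ind => [|x1 y|c x1|a n y n0].
- exact: in_imF0.
- exact: in_imFD.
- exact: in_imFZ.
- exact: (in_imF_opF (M := frob_graded M)).
Qed.

Fact frob_X3 : axiomX3 (frob_graded M).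
Proof.
move=> nu; split=> [x|x].
  have [y [z [ky iz ->]]] : exists y z : opt_space M (divw l nu),
      [/\ opt_kerE y, opt_imF z & x = y + z].
    move: x; rewrite /= /frob_space; case: (divw l nu) => [mu|] x /=.
      exact: (X3 M mu).1.
    by exists 0, 0; rewrite addr0 (@opt_space_none M x).
  by exists y, z; split=> //; [exact/frob_kerE | exact/frob_imF].
move=> /frob_kerE + /frob_imF; move: x; rewrite /= /frob_space.
case: (divw l nu) => [mu|] x /=; first exact: (X3 M mu).2.
by rewrite (@opt_space_none M x).
Qed.

Definition frob_ob : Xob Pi q := XOb frob_X1 frob_X2 frob_X3.

Lemma frob_generated_below la :
  generated_below la M -> generated_below (la *+ l) frob_ob.
Proof.
move=> [dimM bM gM]; split.
- by rewrite /= /frob_space divwMn.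
- by move=> nu /frob_support [mu -> /bM le]; exact: wle_mul.
- move=> nu x nula; apply/frob_imF; move: x; rewrite /= /frob_space.
  case enu : (divw l nu) => [mu|] //= x; apply: gM.
  by apply: contraNneq nula => <-; rewrite -(divw_some l_gt0 enu).
Qed.

End ObjectX.

Section Morphism.
Variables (M N : Xob Pi (1 : K)) (f : Xhom M N).

Definition opt_hom o : 'Hom(opt_space M o, opt_space N o) :=
  if o is Some mu then f mu else \1%VF.

Fact frob_homE a n mu nu :
  (opt_hom (divw l nu) \o frob_opE M a n mu nu)%VF =
  (frob_opE N a n mu nu \o opt_hom (divw l mu))%VF.
Proof.
rewrite /frob_opE /frob_space.
case: (divw l mu) => [mu0|]; case: (divw l nu) => [nu0|];
  rewrite ?comp_lfun0l ?comp_lfun0r //=.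
case: ifP => _; last by rewrite comp_lfun0l comp_lfun0r.
by rewrite -comp_lfunZr -comp_lfunZl XmapE.
Qed.

Fact frob_homF a n nu mu :
  (opt_hom (divw l mu) \o frob_opF M a n nu mu)%VF =
  (frob_opF N a n nu mu \o opt_hom (divw l nu))%VF.
Proof.
rewrite /frob_opF /frob_space.
case: (divw l mu) => [mu0|]; case: (divw l nu) => [nu0|];
  rewrite ?comp_lfun0l ?comp_lfun0r //=.
case: ifP => _; last by rewrite comp_lfun0l comp_lfun0r.
by rewrite -comp_lfunZr -comp_lfunZl XmapF.
Qed.

Definition frob_hom : Xhom (frob_ob M) (frob_ob N) :=
  @XHom _ _ _ _ _ _ (frob_ob M) (frob_ob N) (fun nu => opt_hom (divw l nu))
    frob_homE frob_homF.

End Morphism.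

Fact frob_hom_id (M : catX Pi (1 : K)) :
  frob_hom (idm M) = idm (frob_ob M : catX Pi q).
Proof. by apply: XhomP => nu; rewrite /= /frob_space; case: (divw l nu). Qed.

Fact frob_hom_comp (M N P : catX Pi (1 : K))
    (f : Defs.hom N P) (g : Defs.hom M N) :
  frob_hom (Defs.comp f g) =
  Defs.comp (frob_hom f : Defs.hom (frob_ob N : catX Pi q) (frob_ob P))
    (frob_hom g).
Proof.
apply: XhomP => nu; rewrite /= /frob_space; case: (divw l nu) => //=.
by rewrite comp_lfun1l.
Qed.

Definition frobenius : functor (catX Pi (1 : K)) (catX Pi q) :=
  @Functor (catX Pi 1) (catX Pi q) frob_ob frob_hom frob_hom_id frob_hom_comp.

End Frobenius.

Theorem theoremB (F : archiRealFieldType) (V : vectType F) (R : rootSystem V)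
    (Pi : rootBasis R) (K : fieldType) (q : K) (l : nat) :
  simply_laced Pi ->
  q != 0 ->
  quantum_characteristic q l ->
  (0 < l)%N ->
  (q != 1 -> q != -1 -> exists2 n : nat, odd n & n.-primitive_root q) ->
  exists Frob : functor (catX Pi (1 : K)) (catX Pi q),
    forall (la : weight R) (S1 : catX Pi (1 : K)) (Sq : catX Pi q),
      is_S la S1 -> is_S (la *+ l) Sq -> isomorphic (Frob S1) Sq.
Proof.
move=> sl q0 qchar l0 _.
have [ql qlt] : specialize q (qint qv l%:Z) = 0 /\
    forall k : nat, (0 < k < l)%N -> specialize q (qint qv k%:Z) != 0.
  by case: qchar => [[e _]|[_ ql qlt]]; [rewrite e in l0 | split].
exists (frobenius l0 (frob_sign_sqr q0 ql)
  (fun a b => simply_laced_pairing_sym sl) (gbin_lucas q0 l0 ql qlt)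
  (gbin_l_ndvd q0 l0 ql qlt)) => la S1 Sq S1P SqP.
apply: generated_below_iso (is_S_generated SqP).
exact/frob_generated_below/is_S_generated.
Qed.
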